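(* Let $p$ and $r$ be primes and suppose that an elementary abelian $r$-group $A$ of order $r^2$ acts by automorphisms on a finite $p$-solvable group $G$, that this action is good, and that $C_G(a)$ is $p$-nilpotent for each nonidentity $a\in A$. Then $G$ is $p$-nilpotent by $p$-nilpotent, i.e. $G$ has a $p$-nilpotent normal subgroup $N$ with $G/N$ $p$-nilpotent.
   Context: All groups are finite. If a group $A$ acts on a group $G$ by automorphisms, the action is called good if $H=[H,B]C_H(B)$ for every subgroup $B\le A$ and every $B$-invariant subgroup $H\le G$. *)

(* Defs.v *)
From mathcomp Require Import all_boot all_fingroup all_solvable.
Set Implicit Arguments. Unset Strict Implicit. Unset Printing Implicit Defensive.
Import GroupScope.
Local Open Scope group_scope.

Section Defs.
Variables (gT aT : finGroupType).

Definition p_nilpotent (p : nat) (G : {set gT}) : Prop :=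
  exists K : {group gT}, K <| G /\ p^'.-Hall(G) K.

Definition p_solvable (p : nat) (G : {group gT}) : Prop :=
  exists s : seq {group gT},
    path (fun H K : {group gT} =>
            (H <| K) && (p.-group (K / H) || p^'.-group (K / H))) 1%G s
    /\ last 1%G s = G.

(* An action of A by automorphisms on G is given by a homomorphism
   phi : A -> {perm gT} with phi @* A \subset Aut G. *)
End Defs.

Section ActDefs.
Variables (gT aT : finGroupType) (A : {group aT}) (phi : {morphism A >-> {perm gT}}).

Definition act_invariant (B : {set aT}) (H : {set gT}) : Prop :=
  forall b, b \in B -> phi b @: H \subset H.

Definition act_comm (H : {set gT}) (B : {set aT}) : {set gT} :=
  <<[set x^-1 * phi b x | x in H, b in B]>>.

Definition act_cent (H : {set gT}) (B : {set aT}) : {set gT} :=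
  [set x in H | [forall b in B, phi b x == x]].

Definition good_action (G : {set gT}) : Prop :=
  forall (B : {group aT}) (H : {group gT}),
    B \subset A -> H \subset G -> act_invariant B H ->
    (H : {set gT}) = act_comm H B * act_cent H B.
End ActDefs.

(* Main.v *)
(** Work in the semidirect product [GA].  Goodness lifts the fixed points of the
    subgroups of [A] from [A]-invariant quotients of [G], and makes [A] act trivially
    on its invariant [r]-subgroups.  Replace [G] by [G / O_p'(G)], so that [V = O_p(G)]
    contains its centraliser.

    If [p = r] then [A] centralises [V], so [[G, A] <= C_G(V) <= V <= C_G(A)], and
    [A] centralises [G = [G, A] C_G(A)]; hence [G] is one of the [C_G(a)].

    If [p <> r] then [V] is generated by the [C_V(a)], each centralised by the
    [p']-elements of [C_G(A)]; so [C_G(A)] is a [p]-group, and since it contains a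
    Sylow [r]-subgroup of [G] the action is coprime.  Let [K = O_{p,p'}(G)], let [Q] be
    an [A]-invariant Sylow [q]-subgroup of [K], and let [L = N_G(Q)], which covers
    [G / K].  For each chief factor [U] of [LA] in [V], some nontrivial [c] in [A]
    satisfies [[Q, c] <= C(U)], and then [[L, c]] centralises [Q / C_Q(U)].
    Consequently a [p]-subgroup of [G / K] contained in all the [[G / K, c]] centralises
    [K / V], so it is trivial.  The subgroup [[O_p(G / K), O_p'(C_{G / K}(a))]] is of
    this kind, so the fixed points of each [a] in [G / K], and then [G / K] itself, are
    [p]-groups. *)
Require Import Defs.
From mathcomp Require Import all_boot ssralg all_fingroup all_solvable.
Set Implicit Arguments. Unset Strict Implicit. Unset Printing Implicit Defensive.
Local Open Scope group_scope.

(** * Traces of coprime operators on an abelian group *)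

Section Traces.
Import GRing.Theory FiniteModule.
Variable gT : finGroupType.

(* With [r] the common order of the elements [f x], summing over [x] in [Y] the traces
   of [u] under the [<f x>] gives [#|Y| u] plus the [Y]-traces of the [u ^ (c ^+ j)]
   for [0 < j < r]. *)
Lemma coprime_trace_sub (U Y W : {group gT}) (c : gT) (f : gT -> gT) (r : nat) :
    abelian U -> coprime #|U| #|Y| -> Y \subset 'N(U) -> c \in 'N(U) -> (0 < r)%N ->
    (forall x, x \in Y -> f x ^+ r = 1) ->
    (forall x j, x \in Y -> (0 < j < r)%N -> c ^- j * f x ^+ j \in Y) ->
    (forall j, (0 < j < r)%N -> {in Y &, injective (fun x => c ^- j * f x ^+ j)}) ->
    (forall x, x \in Y -> f x \in 'N(U)) ->
    (forall x, x \in Y -> 'C_U[f x] \subset W) -> 'C_U(Y) \subset W ->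
  U \subset W.
Proof.
move=> abU coUY nUY nUc r_gt0 frE fY finj nUf sCfW sCYW.
have nU x : x \in Y -> x \in 'N(U) by apply: subsetP.
pose N (w : fmod_of abU) := (\sum_(y in Y) (w ^@ y))%R.
have NP w : val (N w) \in W.
  apply: (subsetP sCYW); rewrite inE fmodP; apply/centP=> z Yz; apply/commgP/conjg_fixP.
  rewrite -(fmvalJ _ (nU z Yz)); congr (val _).
  rewrite /N (actr_sum z) [RHS](reindex_inj (mulIg z)) /=.
  apply: eq_big => [y|y Yy]; first by rewrite groupMr.
  by rewrite actrM ?nU.
have eqN j u : (0 < j < r)%N -> (\sum_(x in Y) (u ^@ (f x ^+ j)) = N (u ^@ (c ^+ j)))%R.
  move=> ltj; pose g x := c ^- j * f x ^+ j.
  (* By injectivity [g] permutes [Y], so for fixed [j] the sum over [x] is a full [Y]-trace. *)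
  have im : [set g x | x in Y] = Y.
    apply/eqP; rewrite eqEcard card_in_imset ?leqnn ?andbT; last exact: finj.
    by apply/subsetP=> _ /imsetP[x Yx ->]; apply: fY.
  rewrite /N -[in RHS]im big_imset //=; last exact: finj.
  apply: eq_bigr => x Yx; rewrite -actrM ?groupX // ?mulKVg //.
  by rewrite groupM ?groupV ?groupX ?nUf.
pose M x (u : fmod_of abU) := (\sum_(j < r) (u ^@ (f x ^+ j)))%R.
have fixP x u : x \in Y -> val (M x u) \in W.
  move=> Yx; apply: (subsetP (sCfW x Yx)); apply/setIP; split; first exact: fmodP.
  apply/cent1P/commgP/conjg_fixP; rewrite -(fmvalJ _ (nUf x Yx)).
  congr (val _); rewrite {}/M (actr_sum (f x)).
  case: r r_gt0 frE {fY finj eqN} => // r _ frE; rewrite big_ord_recr big_ord_recl /=.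
  rewrite -actrM ?groupX ?nUf // -expgSr frE // addrC expg0; congr (_ + _)%R.
  by apply: eq_bigr => i _; rewrite -actrM ?groupX ?nUf // -expgSr.
apply/subsetP=> x Ux.
have key : x ^+ #|Y| \in W.
  pose u := fmod abU x.
  have sumE : (\sum_(z in Y) \sum_(j < r) (u ^@ (f z ^+ j)) =
     u *+ #|Y| + \sum_(j < r | (0 < j)%N) N (u ^@ (c ^+ j)))%R.
    rewrite exchange_big /= (bigD1 (Ordinal r_gt0)) //=; congr (_ + _)%R.
      by rewrite -sumr_const; apply: eq_bigr => z _; rewrite expg0 actr1.
    apply: eq_big => [j|j jn0]; first by rewrite -val_eqE /= lt0n.
    by rewrite eqN // ltn_ord andbT lt0n.
  have memsum (I : finType) (P : pred I) (F : I -> fmod_of abU) :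
      (forall i, P i -> val (F i) \in W) -> val (\sum_(i | P i) F i)%R \in W.
    move=> WF; elim/big_rec: _ => [|i v Pi Wv]; first by rewrite fmval0 group1.
    by rewrite fmvalA groupM ?WF.
  have := memsum _ (mem Y) _ (fun z Yz => fixP z u Yz).
  rewrite sumE fmvalA groupMr; last by apply: memsum.
  by rewrite fmvalZ fmodK.
by rewrite -(expgK coUY Ux) groupX.
Qed.

(** [c] acts on [Y] as in a Frobenius group, so the trace lemma applies to the conjugates [c ^ x]:
    the element [c ^- j * (c ^ x) ^+ j] is the commutator of [c ^+ j] with [x]. The subgroups
    ['C_U[c ^ x]] lie in [W], being conjugates of ['C_U[c]] under [Y], and ['C_U(Y)] contributes
    nothing to [[~: U, Y]]. *)
Lemma Frobenius_comm_sub (U Y W : {group gT}) (c : gT) :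
  abelian U -> prime #[c] -> c \in 'N(U) -> c \in 'N(Y) -> Y \subset 'N(U) ->
  coprime #|U| #|Y| -> 'C_Y[c] = 1 -> Y \subset 'N(W) -> 'C_U[c] \subset W ->
  [~: U, Y] \subset W.
Proof.
move=> abU pr_c nUc nYc nUY coUY regY nWY sCW.
have regX j : (0 < j < #[c])%N -> 'C_Y[c ^+ j] = 1.
  case/andP=> j_gt0 ltjc; rewrite -regY -!cent_cycle; congr (_ :&: 'C(_)).
  apply/eqP; rewrite eqEsubset cycle_subG mem_cycle /=.
  apply/setIidPl; apply/eqP; apply: contraTT ltjc => tiC; rewrite -leqNgt.
  have /prime_TIg/=-/(_ <[c ^+ j]>%G) := pr_c : prime #|<[c]>|.
  have [sC _ | _ /(_ isT)/eqP] := boolP (<[c]> \subset <[c ^+ j]>).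
    by rewrite (setIidPl sC) eqxx in tiC.
  by rewrite (setIidPr _) ?cycle_subG ?mem_cycle // cycle_eq1 -order_dvdn => /dvdn_leq->.
have sUWC : U \subset (W :&: U) <*> 'C_U(Y).
  apply: (@coprime_trace_sub U Y _ c (fun x => c ^ x) #[c]) => //.
  - by move=> x Yx; rewrite -conjXg expg_order conj1g.
  - move=> x j Yx _; rewrite -conjXg -commgEl commgEr groupM //.
    by rewrite memJ_norm ?groupV // groupX.
  - move=> j ltj x y Yx Yy /=; rewrite -!conjXg => /mulgI eqxy.
    apply/eqP; rewrite eq_mulgV1 -in_set1 -[[set 1]]/(gval 1%G) /= -(regX j ltj).
    rewrite inE groupM ?groupV //= cent1C; apply/cent1P/commgP/conjg_fixP.
    by rewrite conjgM eqxy -conjgM mulgV conjg1.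
  - by move=> x Yx; rewrite groupJ // (subsetP nUY).
  - move=> x Yx; rewrite (subset_trans _ (joing_subl _ _)) // subsetI subsetIl andbT.
    have nUx := subsetP nUY x Yx; have nWx := subsetP nWY x Yx.
    by rewrite cent1J -{1}(normP nUx) -conjIg -(normP nWx) conjSg.
  exact: joing_subr.
have cWC : 'C_U(Y) \subset 'C(W :&: U) by rewrite (sub_abelian_cent2 abU) ?subsetIl ?subsetIr.
rewrite gen_subG; apply/subsetP=> _ /imset2P[u y Uu Yy ->].
have := subsetP sUWC u Uu; rewrite joingC cent_joinEl //.
case/mulsgP=> k w /setIP[Uk cYk] /setIP[Ww _] ->.
have /commgP/eqP cky := centP cYk y Yy; rewrite commMgJ cky conj1g mul1g.
by rewrite commgEl groupM ?groupV // memJ_norm // (subsetP nWY).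
Qed.

End Traces.

(** * Coprime action: fixed points in quotients and generation by fixed points *)

Lemma coprime_sol_quotient_cent (gT : finGroupType) (B V M : {group gT}) :
  solvable B -> B \subset 'N(M) -> M \subset V -> coprime #|M| #|B| ->
  'C_(V / M)(B / M) = 'C_V(B) / M.
Proof.
move=> solB nMB sMV coMB; rewrite strongest_coprime_quotient_cent ?solB ?orbT //.
  by rewrite subIset ?sMV.
by rewrite (coprimeSg _ coMB) ?subsetIl.
Qed.

Lemma coprime_quotient_cent1 (gT : finGroupType) (a : gT) (V M : {group gT}) :
    a \in 'N(M) -> M \subset V -> coprime #|M| #[a] ->
  'C_(V / M)[coset M a] = 'C_V[a] / M.
Proof.
move=> nMa sMV coMa; rewrite -(cent_cycle a) -coprime_sol_quotient_cent //; first 1 last.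
- by rewrite abelian_sol ?cycle_abelian.
- by rewrite cycle_subG.
by rewrite quotient_cycle // cent_cycle.
Qed.

Lemma quotient_abelem_TI (gT : finGroupType) (r n : nat) (A M : {group gT}) :
  r.-abelem A -> #|A| = n -> A \subset 'N(M) -> coprime #|M| #|A| ->
  r.-abelem (A / M) /\ #|A / M| = n.
Proof.
move=> abelA <- nMA coMA; split; first exact: quotient_abelem.
by rewrite -(card_isog (quotient_isog _ _)) // coprime_TIg.
Qed.

(** For abelian [V] this is the trace lemma with [Y = <[b]>] and [f x = a * x], where [a] and [b]
    generate [A]: the subgroups [<[b]>] and [<[a * x]>] are all those of order [r]. The solvable
    case follows by induction, dividing by a minimal normal subgroup of [V <*> A] inside [V]. *)
Lemma coprime_abelem_gen_cent1 (gT : finGroupType) (r : nat) (A V W : {group gT}) :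
    prime r -> r.-abelem A -> #|A| = (r ^ 2)%N -> solvable V -> A \subset 'N(V) ->
    coprime #|V| #|A| -> (forall a, a \in A^# -> 'C_V[a] \subset W) ->
  V \subset W.
Proof.
move=> pr_r abelA oA.
have [m] := ubnP #|V|; elim: m gT A V W abelA oA => // m IHm gT A V W abelA oA.
rewrite ltnS => leVm solV nVA coVA sCW.
have [-> | ntV] := eqVneq V 1%G; first exact: sub1G.
have [rA abA eA] := and3P abelA.
have [abV | nabV] := boolP (abelian V).
  have [b Ab ntb] : exists2 b, b \in A & b != 1.
    apply/trivgPn; rewrite trivg_card1 oA.
    by rewrite -(expn0 r) eqn_exp2l ?prime_gt1.
  have ob := abelem_order_p abelA Ab ntb.
  have [a Aa nab] : exists2 a, a \in A & a \notin <[b]>.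
    apply/subsetPn; apply: contra (_ : ~~ (r ^ 2 <= r)%N).
      by move/subset_leq_card; rewrite oA -/#[b] ob.
    by rewrite -ltnNge -{1}(expn1 r) ltn_exp2l ?prime_gt1.
  have cab x y : x \in A -> y \in A -> commute x y by move=> *; apply: (centsP abA).
  have sbA : <[b]> \subset A by rewrite cycle_subG.
  have bA x : x \in <[b]> -> x \in A by apply: (subsetP sbA).
  have xr x : x \in A -> x ^+ r = 1 by case/abelemP: abelA => // _; apply.
  apply: (@coprime_trace_sub _ V <[b]> W a (fun x => a * x) r) => //.
  - by apply: coprimegS coVA.
  - exact: subset_trans nVA.
  - exact: (subsetP nVA).
  - exact: prime_gt0.
  - by move=> x bx; rewrite xr // groupM // bA.
  - move=> x j bx _; rewrite expgMn; last by apply: cab => //; apply: bA.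
    by rewrite mulKg groupX.
  - move=> j ltj x y bx by_ /=; rewrite !expgMn; try by apply: cab => //; apply: bA.
    rewrite !mulKg => /(congr1 (fun z => z ^+ (expg_invn <[b]> j))).
    have co : coprime #|<[b]>| j.
      by rewrite -/#[b] ob prime_coprime // gtnNdvd //; case/andP: ltj.
    by rewrite !(expgK co).
  - by move=> x bx; rewrite (subsetP nVA) // groupM // bA.
  - move=> x bx; apply: sCW; apply/setD1P; split; last by rewrite groupM // bA.
    apply: contraNneq nab => ax1; rewrite -groupV.
    by move/eqP: ax1; rewrite -eq_invg_mul => /eqP->.
  by rewrite (subset_trans _ (sCW b _)) ?cent_cycle // !inE ntb.
have nVVA : V <*> A \subset 'N(V) by rewrite join_subG normG.
have [M minM sMV] := minnormal_exists ntV nVVA.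
have [nMVA ntM /is_abelemP[q _ abelM]] := minnormal_solvable minM sMV solV.
have [nMV nMA] := joing_subP nMVA.
have coMA := coprimeSg sMV coVA.
have sMW : M \subset W.
  apply: IHm abelA oA _ (solvableS sMV solV) nMA coMA _ => //.
    apply: leq_trans leVm; apply: proper_card; rewrite properEneq sMV andbT.
    by apply: contraNneq nabV => <-; apply: abelem_abelian abelM.
  by move=> a Aa; apply: subset_trans (sCW a Aa); apply: setSI.
have [abelAM oAM] := quotient_abelem_TI abelA oA nMA coMA.
have : V / M \subset W / M.
  apply: IHm abelAM oAM _ (quotient_sol _ solV) (quotient_norms _ nVA) _ _.
  - by apply: leq_trans leVm; apply: ltn_quotient.
  - by rewrite coprime_morph.
  move=> x /setD1P[ntx /morphimP[a nMa Aa def_x]]; rewrite def_x.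
  rewrite coprime_quotient_cent1 //; last by apply: coprimegS coMA; rewrite cycle_subG.
  apply: quotientS; apply: sCW; rewrite !inE Aa andbT.
  by apply: contraNneq ntx => a1; rewrite def_x a1 morph1.
by rewrite quotientSK // mulSGid.
Qed.

Lemma cycle_prime_eq (gT : finGroupType) (a c : gT) :
  prime #[c] -> a \in <[c]> -> a != 1 -> <[a]> = <[c]>.
Proof.
move=> pr_c ca nta; have sac : <[a]> \subset <[c]> by rewrite cycle_subG.
apply/eqP; rewrite eqEsubset sac /=; apply: contraNT nta => nsca.
have /prime_TIg/=-/(_ <[a]>%G nsca) := pr_c : prime #|<[c]>|.
by rewrite (setIidPr sac) => /eqP; rewrite cycle_eq1.
Qed.

Lemma abelem2_joing (gT : finGroupType) (r : nat) (A : {group gT}) (c d : gT) :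
    prime r -> r.-abelem A -> #|A| = (r ^ 2)%N -> c \in A^# -> d \in A ->
    d \notin <[c]> ->
  <[c]> <*> <[d]> = A.
Proof.
move=> pr_r abelA oA /setD1P[ntc Ac] Ad nd.
have sXA : <[c]> <*> <[d]> \subset A by rewrite join_subG !cycle_subG Ac.
apply/eqP; rewrite eqEcard sXA /= oA.
have: #|<[c]>| < #|<[c]> <*> <[d]>|.
  apply: proper_card; rewrite properE joing_subl /=; apply: contra nd => /subsetP.
  by apply; rewrite mem_gen // inE cycle_id orbT.
have := cardSg sXA; rewrite oA => /(dvdn_pfactor _ _ pr_r)[k _ ->].
rewrite -/#[c] (abelem_order_p abelA Ac ntc) -{1}(expn1 r).
by have r_gt1 := prime_gt1 pr_r; rewrite ltn_exp2l ?leq_exp2l.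
Qed.

Lemma minnormalJ (gT : finGroupType) (T Z : {group gT}) x :
  x \in 'N(Z) -> minnormal T Z -> minnormal (T :^ x)%G Z.
Proof.
move=> nZx /mingroupP[/andP[ntT nTZ] minT]; apply/mingroupP; split.
  by rewrite -(normP nZx) normJ conjSg nTZ andbT -!cardG_gt1 cardJg in ntT *.
move=> K /andP[ntK nKZ] sKT; apply: (canRL (conjsgKV x)).
apply: (minT (K :^ x^-1)%G) => /=; last by rewrite sub_conjgV.
by rewrite -(normP (groupVr nZx)) normJ conjSg nKZ andbT -!cardG_gt1 cardJg in ntK *.
Qed.

Lemma coprime_sol_comm_cent (gT : finGroupType) (A G : {group gT}) :
    solvable A -> A \subset 'N(G) -> coprime #|G| #|A| ->
  [~: G, A] * 'C_G(A) = G.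
Proof.
move=> solA nGA coGA; have sMG : [~: G, A] \subset G by rewrite commg_subl.
have nMG : G \subset 'N([~: G, A]) := commg_norml G A.
have nMA : A \subset 'N([~: G, A]) := commg_normr A G.
have := @coprime_sol_quotient_cent _ A G [~: G, A]%G solA nMA sMG (coprimeSg sMG coGA).
rewrite (setIidPl _) => [eqGC|]; last by rewrite quotient_cents2r.
apply/eqP; rewrite eqEsubset mul_subG ?subsetIl //=.
by rewrite -quotientSK // eqGC.
Qed.

(** [E] covers [A] modulo [L], so [L :&: E] is a normal Hall subgroup of [E] with a complement of
    order [#|A|]. By Schur-Zassenhaus that complement is conjugate to [A] under [L]. *)
Lemma coprime_cent_conj (gT : finGroupType) (L A E : {group gT}) :
    solvable A -> A \subset 'N(L) -> coprime #|L| #|A| -> E \subset L <*> A ->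
    A \subset L * E ->
  exists2 x, x \in L & A :^ x \subset E.
Proof.
move=> solA nLA coLA sEH sAE.
have defH : L * A = L <*> A by rewrite norm_joinEr.
have sELA : L * E = L * A.
  apply/eqP; rewrite eqEsubset defH mul_subG ?joing_subl //= -defH.
  by have := mulgS L sAE; rewrite mulgA mulGid.
have nLE : E \subset 'N(L) by rewrite (subset_trans sEH) // join_subG normG.
have nKE : L :&: E <| E by rewrite /normal subsetIr normsI ?normG.
have oE : #|E| = (#|L :&: E| * #|A|)%N.
  apply/eqP; rewrite -(eqn_pmul2l (cardG_gt0 L)) mul_cardG sELA.
  by rewrite (TI_cardMg (coprime_TIg coLA)) -mulnA [(#|A| * _)%N]mulnC.
have hallK : Hall E (L :&: E).
  rewrite /Hall subsetIr -divgS ?subsetIr // oE mulKn ?cardG_gt0 //=.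
  exact: coprimeSg (subsetIl _ _) coLA.
have /splitsP[B /complP[tiKB defE]] := SchurZassenhaus_split hallK nKE.
have sBE : B \subset E by rewrite -defE mulG_subr.
have [||x Lx defB] := SchurZassenhaus_trans_actsol solA nLA _ coLA (B := B).
- by rewrite joingC (subset_trans sBE).
- apply/eqP; rewrite -(eqn_pmul2l (cardG_gt0 (L :&: E)%G)) -oE.
  by rewrite -(TI_cardMg tiKB) defE.
by exists x; rewrite // -defB.
Qed.

(** * The action of [Q] on the chief factors of [L <*> A] *)

Lemma abelem2_cent1 (gT : finGroupType) (r : nat) (A K : {group gT}) (c d : gT) :
    prime r -> r.-abelem A -> #|A| = (r ^ 2)%N -> c \in A^# -> d \in A ->
    d \notin <[c]> ->
  'C_K[c] :&: 'C[d] = 'C_K(A).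
Proof.
move=> pr_r abelA oA Ac Ad ncd; rewrite -(abelem2_joing pr_r abelA oA Ac Ad ncd).
by rewrite centY !cent_cycle setIA.
Qed.

(** The centre [Z] of [Q] comes first. On a minimal [Z]-invariant subgroup [T] of [U] some [[~: Z,
    <[c]>]] acts trivially, and the same [c] serves every conjugate of [T] under [L <*> A]. These
    conjugates generate [U], so [c] centralises [Z] by faithfulness. Every [a] outside [<[c]>] then
    has ['C_Q[a] = 1], and the ['C_Q[a]] generate [Q]. *)
Lemma faithful_minnormal_cent (gT : finGroupType) (r : nat) (U L Q A : {group gT}) :
    prime r -> r.-abelem A -> #|A| = (r ^ 2)%N ->
    A \subset 'N(L) -> coprime #|L| #|A| -> Q \subset L -> L <*> A \subset 'N(Q) ->
    nilpotent Q -> abelian U -> minnormal U (L <*> A) -> coprime #|U| #|A| ->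
    coprime #|U| #|Q| -> 'C_Q(U) = 1 ->
    {in A^#, forall a, 'C_Q[a] \subset 'C('C_U[a])} ->
  exists2 c, c \in A^# & Q \subset 'C[c].
Proof.
move=> pr_r abelA oA nLA coLA sQL nQH nilQ abU minU coUA coUQ faithQ cQU.
have [rA abA eA] := and3P abelA; have solA := abelian_sol abA.
have [c0 Ac0] : exists c, c \in A^#.
  apply/set0Pn; rewrite setD_eq0 subG1 trivg_card1 oA.
  by rewrite -(expn0 r) eqn_exp2l ?prime_gt1.
have ordA c : c \in A^# -> prime #[c].
  by case/setD1P=> ntc Ac; rewrite (abelem_order_p abelA).
set H := L <*> A in nQH minU *.
have [/andP[ntU nUH] minUP] := mingroupP minU.
have [[nUL nUA] [nQL nQA]] := (joing_subP nUH, joing_subP nQH).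
have coQA := coprimeSg sQL coLA.
(* An element of ['C_Q(A)] lies in every ['C_Q[a]], so it centralises every ['C_U[a]], and these
   generate [U]. *)
have regQ : 'C_Q(A) = 1.
  apply/trivgP/subsetP=> x /setIP[Qx cAx]; rewrite -faithQ inE Qx /= -sub_cent1.
  suffices: U \subset 'C_U[x] by rewrite subsetI subxx.
  apply: (@coprime_abelem_gen_cent1 _ r A U 'C_U[x]%G pr_r abelA oA) => //.
    exact: abelian_sol.
  move=> a Aa; rewrite subsetI subsetIl /= sub_cent1; have [_ Aa1] := setD1P Aa.
  apply: (subsetP (cQU a Aa)); rewrite inE Qx /=.
  by apply/cent1P; apply: (centP cAx).
have [trQ | ntQ] := eqVneq Q 1%G; first by exists c0; rewrite // trQ sub1G.
set Z := 'Z(Q); have sZQ : Z \subset Q := center_sub Q.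
have ntZ : Z != 1 by rewrite center_nil_eq1.
have abZ : abelian Z := center_abelian Q.
have nZH : H \subset 'N(Z) := char_norm_trans (center_char Q) nQH.
have [nZL nZA] := joing_subP nZH.
have cZQ : Q \subset 'C(Z) by rewrite centsC subsetIr.
have coZA := coprimeSg sZQ coQA; have coUZ := coprimegS sZQ coUQ.
have nUZ : Z \subset 'N(U) := subset_trans (subset_trans sZQ sQL) nUL.
have regZ : 'C_Z(A) = 1 by apply/trivgP; rewrite -regQ setSI.
have nZc c : c \in A -> <[c]> \subset 'N(Z).
  by move=> Ac; rewrite cycle_subG (subsetP nZA).
(* [C_Q[c]] centralises [C_U[c]] and its conjugates under [Z], which generate
   [[U, [Z, c]]] since [[Z, c] <c>] is a Frobenius group. *)
have Frob c : c \in A^# -> [~: U, [~: Z, <[c]>]] \subset 'C('C_Q[c]).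
  move=> A1c; have [ntc Ac] := setD1P A1c; have sDZ : [~: Z, <[c]>] \subset Z.
    by rewrite commg_subl nZc.
  have coZc : coprime #|Z| #|<[c]>| by apply: coprimegS coZA; rewrite cycle_subG.
  apply: (@Frobenius_comm_sub _ U [~: Z, <[c]>]%G 'C('C_Q[c])%G c) => //=.
  - exact: ordA.
  - exact: (subsetP nUA).
  - by rewrite -cycle_subG commg_normr.
  - exact: subset_trans nUZ.
  - exact: coprimegS coUZ.
  - by rewrite -cent_cycle coprime_abel_cent_TI ?nZc.
  - apply: subset_trans (normG _); rewrite (subset_trans sDZ) // centsC.
    by rewrite subIset ?cZQ.
  by rewrite centsC cQU.
(* If no [c] works, minimality of [T] gives ['C_T([~: Z, <[c]>]) = 1], so [T = [~: T, [~: Z,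
   <[c]>]]] is centralised by ['C_Z[c]], for every [c]. These subgroups generate [Z], so [Z]
   centralises [T] and any [c] works after all. *)
have typeT (T : {group gT}) : minnormal T Z -> T \subset U ->
    exists2 c, c \in A^# & [~: Z, <[c]>] \subset 'C(T).
  move=> minT sTU; apply/exists_inP; apply: contraT => /exists_inPn noc.
  have [/andP[ntT nTZ] minTP] := mingroupP minT.
  have cZT : Z \subset 'C_Z(T).
    apply: (@coprime_abelem_gen_cent1 _ r A _ 'C_Z(T)%G pr_r abelA oA) => //.
      exact: abelian_sol.
    move=> c A1c; rewrite subsetI subsetIl /= centsC.
    have [ntc Ac] := setD1P A1c; set D := [~: Z, <[c]>].
    have sDZ : D \subset Z by rewrite commg_subl nZc.
    have [nTD cZD] := (subset_trans sDZ nTZ, centsS sDZ abZ).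
    have nCZ : Z \subset 'N('C_T(D)).
      by rewrite normsI // (subset_trans _ (normG _)) // centsC.
    have regD : 'C_T(D) = 1.
      apply: contraNeq (noc c A1c) => ntC; rewrite centsC.
      by rewrite -(minTP 'C_T(D)%G) ?ntC ?subsetIl ?subsetIr.
    have coTD : coprime #|T| #|D| := coprimeSg sTU (coprimegS sDZ coUZ).
    rewrite -(coprime_sol_comm_cent (abelian_sol (abelianS sDZ abZ)) nTD coTD) regD mulg1.
    apply: subset_trans (commSg _ sTU) (subset_trans (Frob c A1c) _).
    by rewrite centS // setSI.
  case/negP: (noc c0 Ac0); apply: subset_trans (subset_trans cZT (subsetIr _ _)).
  by rewrite commg_subl nZc //; case/setD1P: Ac0.
have sZL := subset_trans sZQ sQL.
have regUZ : 'C_U(Z) = 1.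
  apply: contraNeq ntZ => ntC; rewrite -subG1 -faithQ subsetI sZQ centsC.
  rewrite -{1}(minUP 'C_U(Z)%G) ?subsetIl ?subsetIr // ntC.
  by rewrite normsI // norms_cent.
have [T minT sTU] := minnormal_exists ntU nUZ.
have [c A1c cTc] := typeT T minT sTU; have [ntc Ac] := setD1P A1c.
(* If [c] and [d] are the elements found for [T] and [T ^ x] and [d] does not generate
   [<c>], then [<c ^ x, d>] contains a conjugate of [A], acts trivially on
   [Z / C_Z(T ^ x)], and so forces [Z = C_Z(T ^ x)] because [C_Z(A) = 1]. *)
have cTxc x : x \in H -> [~: Z, <[c]>] \subset 'C(T :^ x).
  move=> Hx; have nZx := subsetP nZH x Hx.
  have minTx := minnormalJ nZx minT.
  have sTxU : T :^ x \subset U by rewrite -(normP (subsetP nUH x Hx)) conjSg.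
  have [d A1d cTd] := typeT _ minTx sTxU; have [ntd Ad] := setD1P A1d.
  have [dc | ndc] := boolP (c \in <[d]>).
    by rewrite (subset_trans _ cTd) // commgS // cycle_subG.
  pose Y := ('C_Z(T :^ x))%G; pose E := (<[c ^ x]> <*> <[d]>)%G.
  have nYZ : Z \subset 'N(Y) by rewrite sub_abelian_norm ?subsetIl.
  have sYc : [~: Z, <[c ^ x]>] \subset Y.
    have -> : [~: Z, <[c ^ x]>] = [~: Z, <[c]>] :^ x.
      by rewrite conjsRg (normP nZx) cycleJ.
    have sZxc : [~: Z, <[c]>] :^ x \subset Z :^ x by rewrite conjSg commg_subl nZc.
    rewrite (normP nZx) in sZxc; rewrite subsetI sZxc.
    by rewrite /= centJ conjSg.
  have sYd : [~: Z, <[d]>] \subset Y.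
    by rewrite subsetI commg_subl nZc.
  have nYe e : [~: Z, <[e]>] \subset Y -> <[e]> \subset 'N(Y).
    by move=> sY; rewrite -commg_subl (subset_trans _ sY) // commSg ?subsetIl.
  have sYE : [~: Z, E] \subset Y.
    rewrite commGC -quotient_cents2 //; last by rewrite join_subG !nYe.
    rewrite quotientY ?nYe // join_subG !quotient_cents2r //; by rewrite commGC.
  have Hc : c \in H by rewrite (subsetP (joing_subr L A)).
  have Hd : d \in H by rewrite (subsetP (joing_subr L A)).
  (* [H / L] is abelian, so [c ^ x] and [c] agree modulo [L], and [E] covers [A] modulo [L]. *)
  have [||y Ly sAyE] := coprime_cent_conj (E := E) solA nLA coLA.
  - by rewrite join_subG !cycle_subG groupJ.
  - have nLH : H \subset 'N(L) by rewrite join_subG normG.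
    have nLE : E \subset 'N(L) by rewrite join_subG !cycle_subG !(subsetP nLH) ?groupJ.
    have cHH : abelian (H / L) by rewrite quotientYidl ?quotient_abelian.
    have Lcx : [~ c, x] \in L by rewrite (subsetP (der1_min nLH cHH)) ?mem_commg.
    rewrite -norm_joinEr // -(abelem2_joing pr_r abelA oA A1d Ac ndc) join_subG !cycle_subG.
    have Ed : d \in E by rewrite (subsetP (joing_subr _ _)) ?cycle_id.
    have Ecx : c ^ x \in E by rewrite (subsetP (joing_subl _ _)) ?cycle_id.
    rewrite (subsetP (joing_subr L E)) //=.
    have defc : c = c ^ x * [~ c, x]^-1 by rewrite conjg_mulR mulgK.
    have sEX := subsetP (joing_subr L E); have sLX := subsetP (joing_subl L E).
    by rewrite [X in X \in _]defc; apply: groupM; [apply: sEX | apply: sLX; rewrite groupV].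
  have Zy : Z :^ y = Z by rewrite (normP _) // (subsetP nZL).
  have defZ : [~: Z, A] = Z.
    by have := coprime_sol_comm_cent solA nZA coZA; rewrite regZ mulg1.
  (* Conjugating [[~: Z, A] = Z] by [y] gives [Z = [~: Z, A :^ y]], which lies in [[~: Z, E]]. *)
  have sZY : Z \subset Y.
    by rewrite -[in X in X \subset _]Zy -defZ conjsRg Zy (subset_trans _ sYE) ?commgS.
  have [/andP[/negP[]]] := mingroupP minTx.
  by rewrite -subG1 -regUZ subsetI sTxU centsC (subset_trans sZY) ?subsetIr.
have cZc : <[c]> \subset 'C(Z).
  rewrite centsC; apply/commG1P/trivgP; rewrite -faithQ subsetI.
  rewrite (subset_trans _ sZQ) ?commg_subl ?nZc //= centsC.
  rewrite -(minUP <<class_support T H>>%G) /=.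
  - rewrite gen_subG; apply/subsetP=> _ /imset2P[t x Tt Hx ->].
    by apply: (subsetP (_ : T :^ x \subset _)); rewrite ?memJ_conjg // centsC cTxc.
  - rewrite norms_gen ?class_support_norm // andbT.
    have [/andP[ntT _] _] := mingroupP minT; apply: contraNneq ntT => trX.
    by rewrite -subG1 -trX (subset_trans (sub_class_support H T)) ?subset_gen.
  rewrite gen_subG; apply/subsetP=> _ /imset2P[t x Tt Hx ->].
  by rewrite memJ_norm ?(subsetP sTU) // (subsetP nUH).
exists c => //.
apply: subset_trans (subsetIr Q _).
apply: (@coprime_abelem_gen_cent1 _ r A _ 'C_Q[c]%G pr_r abelA oA) => //.
  exact: nilpotent_sol.
move=> a A1a; have [nta Aa] := setD1P A1a.
have [ac | nac] := boolP (a \in <[c]>).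
  by rewrite -(cent_cycle a) (cycle_prime_eq (ordA c A1c) ac nta) cent_cycle.
(* Here [a] is outside [<[c]>]. As [c] centralises [Z], the group ['C_Z[a]] lies in ['C_Z(A) = 1],
   so [[~: Z, <[a]>] = Z]. By [Frob], ['C_Q[a]] centralises [[~: U, Z] = U], so it is trivial. *)
rewrite (subset_trans _ (sub1G _)) // -faithQ subsetI subsetIl /= centsC.
have defZ : [~: Z, <[a]>] = Z.
  have sAa : <[a]> \subset A by rewrite cycle_subG.
  have := coprime_sol_comm_cent (abelian_sol (cycle_abelian a)) (nZc a Aa) (coprimegS sAa coZA).
  rewrite cent_cycle -/Z; have -> : 'C_Z[a] = 1; last by rewrite mulg1.
  apply/trivgP; rewrite -regZ -(abelem2_cent1 Z pr_r abelA oA A1c Aa nac).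
  by rewrite setSI // subsetI subxx -cent_cycle centsC.
have := Frob a A1a; rewrite defZ; apply: subset_trans.
by rewrite -{1}(coprime_sol_comm_cent (abelian_sol abZ) nUZ coUZ) regUZ mulg1.
Qed.

Lemma sol_quotient_cent1 (gT : finGroupType) (a : gT) (V M : {group gT}) :
    a \in 'N(V) -> a \in 'N(M) -> coprime #|M| #[a] -> solvable M ->
  'C_(V / M)[coset M a] = 'C_V[a] / M.
Proof.
move=> nVa nMa coMa solM; rewrite -!cent_cycle coprime_norm_quotient_cent ?cycle_subG //.
by rewrite quotient_cycle.
Qed.

(** Fixed points of [a] lift through the coprime solvable group [M]. It is applied once with [M]
    inside [Q] and once with [M] inside [V], so neither inclusion is assumed. *)
Lemma quotient_fixed_cent (gT : finGroupType) (Q V A M : {group gT}) :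
    A \subset 'N(Q) -> A \subset 'N(V) -> A \subset 'N(M) ->
    coprime #|M| #|A| -> solvable M ->
    {in A^#, forall a, 'C_Q[a] \subset 'C('C_V[a])} ->
  {in (A / M)^#, forall a, 'C_(Q / M)[a] \subset 'C('C_(V / M)[a])}.
Proof.
move=> nQA nVA nMA coMA solM cQV x /setD1P[ntx /morphimP[a nMa Aa def_x]].
have A1a : a \in A^#.
  by rewrite !inE Aa andbT; apply: contraNneq ntx => a1; rewrite def_x a1 morph1.
have coMa : coprime #|M| #[a] by apply: coprimegS coMA; rewrite cycle_subG.
rewrite def_x !sol_quotient_cent1 ?(subsetP nQA) ?(subsetP nVA) //.
by rewrite quotient_cents ?cQV.
Qed.

Lemma minnormal_quotient (gT : finGroupType) (U H M : {group gT}) :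
    H \subset 'N(M) -> U \subset 'N(M) -> U :&: M = 1 -> minnormal U H ->
  minnormal (U / M)%G (H / M)%G.
Proof.
move=> nMH nMU tiUM /mingroupP[/andP[ntU nUH] minU]; apply/mingroupP; split.
  rewrite quotient_norms // andbT -subG1 quotient_sub1 //; apply: contra ntU => sUM.
  by rewrite -subG1 -tiUM subsetI subxx.
move=> K /andP[ntK nKH] sKU; pose X := (U :&: coset M @*^-1 K)%G.
have defK : X / M = K by rewrite quotient_setIpre (setIidPr sKU).
have defX : X :=: U.
  apply: minU; rewrite ?subsetIl //; apply/andP; split.
    by apply: contraNneq ntK => X1; rewrite -defK X1 quotient1.
  rewrite normsI //; apply: subset_trans (morphpre_norm _ _).
  by rewrite -sub_quotient_pre.
by rewrite -defK defX.
Qed.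

Lemma cosetpre_norms (gT : finGroupType) (L M : {group gT}) (X : {set coset_of M}) :
  L \subset 'N(M) -> L / M \subset 'N(X) -> L \subset 'N(coset M @*^-1 X).
Proof.
move=> nML nX; apply: subset_trans (morphpre_norm _ _).
by rewrite -sub_quotient_pre.
Qed.

(** Dividing by the kernel ['C_Q(U)] makes [Q] faithful on [U]. The kernel meets [U] trivially by
    coprimality, so [U] remains minimal normal. *)
Lemma minnormal_cent_exists (gT : finGroupType) (r : nat) (U L Q A : {group gT}) :
    prime r -> r.-abelem A -> #|A| = (r ^ 2)%N ->
    A \subset 'N(L) -> coprime #|L| #|A| -> Q \subset L -> L <*> A \subset 'N(Q) ->
    nilpotent Q -> abelian U -> minnormal U (L <*> A) -> coprime #|U| #|A| ->
    coprime #|U| #|Q| ->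
    {in A^#, forall a, 'C_Q[a] \subset 'C('C_U[a])} ->
  exists2 c, c \in A^# & [~: Q, <[c]>] \subset 'C_Q(U).
Proof.
move=> pr_r abelA oA nLA coLA sQL nQH nilQ abU minU coUA coUQ cQU.
have [/andP[ntU nUH] minUP] := mingroupP minU.
have [[nUL nUA] [nQL nQA]] := (joing_subP nUH, joing_subP nQH).
set M := ('C_Q(U))%G; have sMQ : M \subset Q := subsetIl _ _.
have nMH : L <*> A \subset 'N(M) by rewrite normsI // norms_cent.
have [nML nMA] := joing_subP nMH.
have cUM : U \subset 'C(M) by rewrite centsC subsetIr.
have nMU : U \subset 'N(M) := subset_trans cUM (cent_sub _).
have coUM : coprime #|U| #|M| := coprimegS sMQ coUQ.
have coMA : coprime #|M| #|A| := coprimeSg (subset_trans sMQ sQL) coLA.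
have solQ := nilpotent_sol nilQ; have solM := solvableS sMQ solQ.
have [abelAM oAM] := quotient_abelem_TI abelA oA nMA coMA.
have nMQ := subset_trans sQL nML.
have [|||||||||||c] := @faithful_minnormal_cent _ r (U / M) (L / M) (Q / M) (A / M)
  pr_r abelAM oAM.
- exact: quotient_norms.
- by rewrite coprime_morph.
- exact: quotientS.
- by rewrite -quotientY // quotient_norms.
- exact: quotient_nil.
- exact: quotient_abelian.
- have -> : (L / M) <*> (A / M) = (L <*> A) / M by rewrite quotientY.
  by rewrite minnormal_quotient // coprime_TIg.
- by rewrite coprime_morph.
- by rewrite coprime_morph.
- rewrite coprime_sol_quotient_cent ?abelian_sol //; last by rewrite coprime_sym.
  by rewrite trivg_quotient.
- exact: quotient_fixed_cent.
case/setD1P=> ntc /morphimP[a nMa Aa def_c]; rewrite {}def_c in ntc * => cQa.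
exists a; first by rewrite !inE Aa andbT; apply: contraNneq ntc => ->; rewrite morph1.
by rewrite -quotient_cents2 ?cycle_subG // quotient_cycle // cent_cycle.
Qed.

(* The last hypothesis says that [P] lies in every normal subgroup of [L] that can arise
   as the centraliser of [Q / C_Q(U)], for [U] a chief factor of [LA] in [V]. *)
Lemma coprime_series_cent (gT : finGroupType) (r : nat) (V L Q A P : {group gT}) :
    prime r -> r.-abelem A -> #|A| = (r ^ 2)%N ->
    A \subset 'N(L) -> coprime #|L| #|A| -> Q \subset L -> L <*> A \subset 'N(Q) ->
    nilpotent Q -> nilpotent V -> L <*> A \subset 'N(V) -> coprime #|V| #|A| ->
    coprime #|V| #|Q| ->
    {in A^#, forall a, 'C_Q[a] \subset 'C('C_V[a])} ->
    P \subset L ->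
    (forall c (D : {group gT}), c \in A^# -> D \subset L -> L \subset 'N(D) ->
       [~: L, <[c]>] \subset D -> 'C_L(Q) \subset D -> P \subset D) ->
  [~: Q, P] \subset 'C(V).
Proof.
move=> pr_r; have [m] := ubnP #|V|.
elim: m gT V L Q A P => // m IHm gT V L Q A P; rewrite ltnS => leVm.
move=> abelA oA nLA coLA sQL nQH nilQ nilV nVH coVA coVQ cQV sPL critP.
have [-> | ntV] := eqVneq V 1%G; first exact: cents1.
have ntZV : 'Z(V) != 1 by rewrite center_nil_eq1.
(* [U] is a bottom chief factor, chosen in the centre of [V]. The group [[~: Q, P]] centralises it
   by the faithful case, and centralises [V / U] by induction. *)
have [U minU sUZ] := minnormal_exists ntZV (char_norm_trans (center_char V) nVH).
have solV := nilpotent_sol nilV.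
have [sUV cUV] : U \subset V /\ V \subset 'C(U).
  by rewrite centsC; apply/andP; rewrite -subsetI.
have nUV := subset_trans cUV (cent_sub U).
have [nUH ntU /is_abelemP[q _ abelU]] := minnormal_solvable minU sUV solV.
have abU := abelem_abelian abelU.
have [[nUL nUA] [nQL nQA]] := (joing_subP nUH, joing_subP nQH).
have [nVL nVA] := joing_subP nVH.
have [coUA coUQ] := (coprimeSg sUV coVA, coprimeSg sUV coVQ).
have [nUQ nUP] := (subset_trans sQL nUL, subset_trans sPL nUL).
have sRQ : [~: Q, P] \subset Q by rewrite commg_subl (subset_trans sPL).
have cUQP : [~: Q, P] \subset 'C(U).
  have [|c A1c sQc] := minnormal_cent_exists pr_r abelA oA nLA coLA sQL nQH nilQ abU minU coUA coUQ.
    move=> a A1a; apply: subset_trans (cQV a A1a) _; rewrite centS //.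
    exact: setSI.
  set M := ('C_Q(U))%G in sQc; have sMQ : M \subset Q := subsetIl _ _.
  have nMH : L <*> A \subset 'N(M) by rewrite normsI // norms_cent.
  have [nML nMA] := joing_subP nMH; have nMQ := subset_trans sQL nML.
  have nMc : <[c]> \subset 'N(M) by rewrite cycle_subG (subsetP nMA) //; case/setD1P: A1c.
  (* [c] centralises [Q / M], hence so does [[~: L, <[c]>]]. The centraliser of [Q / M] in [L] is
     therefore one of the groups [D] in [critP]. *)
  suffices sPD : P \subset coset M @*^-1 'C(Q / M).
    rewrite (subset_trans _ (subsetIr Q _)) // -quotient_cents2 //.
      by rewrite centsC sub_quotient_pre // (subset_trans sPL).
    exact: subset_trans nML.
  apply: subset_trans (subsetIr L _).
  apply: (critP c (L :&: coset M @*^-1 'C(Q / M))%G) => //=.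
  - exact: subsetIl.
  - by rewrite normsI ?normG // cosetpre_norms // norms_cent // quotient_norms.
  - have sLcL : [~: L, <[c]>] \subset L.
      by rewrite commg_subl cycle_subG (subsetP nLA) //; case/setD1P: A1c.
    rewrite subsetI sLcL -sub_quotient_pre ?(subset_trans sLcL) //= quotientR //.
    apply: (@subset_trans _ _ [~: L / M, 'C(Q / M)]).
      by rewrite commgS // centsC quotient_cents2.
    by rewrite commg_subr norms_cent // quotient_norms.
  rewrite subsetI subsetIl /= -sub_quotient_pre ?(subset_trans (subsetIl _ _)) //.
  by rewrite quotient_cents // subsetIr.
have [abelAU oAU] := quotient_abelem_TI abelA oA nUA coUA.
have defH : (L / U) <*> (A / U) = (L <*> A) / U by rewrite quotientY.
have cVUQP : [~: Q / U, P / U] \subset 'C(V / U).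
  apply: (IHm _ (V / U)%G (L / U)%G (Q / U)%G (A / U)%G (P / U)%G); rewrite ?defH //=.
  - by apply: leq_trans leVm; apply: ltn_quotient.
  - exact: quotient_norms.
  - by rewrite coprime_morph.
  - exact: quotientS.
  - exact: quotient_norms.
  - exact: quotient_nil.
  - exact: quotient_nil.
  - exact: quotient_norms.
  - by rewrite coprime_morph.
  - by rewrite coprime_morph.
  - exact: quotient_fixed_cent (abelian_sol abU) cQV.
  - exact: quotientS.
  move=> x D /setD1P[ntx /morphimP[c nUc Ac def_x]] sDL nDL; rewrite {}def_x in ntx *.
  move=> sLcD sCD.
  rewrite sub_quotient_pre //; apply: subset_trans (subsetIr L _).
  have A1c : c \in A^# by rewrite !inE Ac andbT; apply: contraNneq ntx => ->; rewrite morph1.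
  have sLcL : [~: L, <[c]>] \subset L by rewrite commg_subl cycle_subG (subsetP nLA).
  apply: (critP c (L :&: coset U @*^-1 D)%G) => //=.
  - exact: subsetIl.
  - by rewrite normsI ?normG // cosetpre_norms.
  - rewrite subsetI sLcL -sub_quotient_pre ?(subset_trans sLcL) //.
    by rewrite quotientR ?cycle_subG // quotient_cycle.
  rewrite subsetI subsetIl /= -sub_quotient_pre ?(subset_trans (subsetIl _ _)) //.
  apply: subset_trans sCD; rewrite subsetI quotientS ?subsetIl //=.
  by rewrite quotient_cents // subsetIr.
(* [B] acts coprimely on [V] and trivially on [U] and [V / U]. So [[~: V, B]] lies in [U], which [B]
   centralises, and [V] is the product of [[~: V, B]] and ['C_V(B)]. *)
set B := [~: Q, P] in sRQ cUQP *.
have nVB : B \subset 'N(V) := subset_trans sRQ (subset_trans sQL nVL).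
have coVB : coprime #|V| #|B| := coprimegS sRQ coVQ.
have solB : solvable B := solvableS sRQ (nilpotent_sol nilQ).
rewrite centsC -(coprime_sol_comm_cent solB nVB coVB) mul_subG ?subsetIr //.
rewrite centsC; apply: subset_trans cUQP (centS _).
rewrite commGC -quotient_cents2 ?(subset_trans sRQ) //.
by rewrite quotientR.
Qed.

(** * Separable groups and their cores *)

(** Quantifying over all nontrivial sections, instead of asking for a series, makes the property
    pass to quotients at once. *)
Definition pi_separable (gT : finGroupType) (pi : nat_pred) (G : {group gT}) : Prop :=
  forall H K : {group gT}, H \subset G -> K <| H -> ~~ (H \subset K) ->
  ('O_pi(H / K) != 1) || ('O_pi^'(H / K) != 1).

Lemma pi_separableC (gT : finGroupType) (pi : nat_pred) (G : {group gT}) :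
  pi_separable pi G -> pi_separable pi^' G.
Proof.
move=> sepG H K sHG nKH nsHK; rewrite orbC.
by rewrite (eq_pcore _ (negnK pi)) sepG.
Qed.

Lemma pi_separable_quotient (gT : finGroupType) (pi : nat_pred) (G N : {group gT}) :
  N <| G -> pi_separable pi G -> pi_separable pi (G / N).
Proof.
move=> nNG sepG H K sHG nKH nsHK.
pose H1 := (coset N @*^-1 H)%G; pose K1 := (coset N @*^-1 K)%G.
have nK1H1 : K1 <| H1 by rewrite cosetpre_normal.
have sNK1 : N \subset K1 := sub_cosetpre _.
have nNH1 : N <| H1 := normal_cosetpre _.
have defH : H1 / N = H := cosetpreK _; have defK : K1 / N = K := cosetpreK _.
have iso := third_isog sNK1 nNH1 nK1H1; rewrite defH defK in iso.
have := sepG H1 K1 _ nK1H1 _.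
rewrite -!(isog_eq1 (isog_pcore _ iso)); apply; first by rewrite sub_cosetpre_quo.
by apply: contra nsHK => sH1K1; rewrite -defH -defK quotientS.
Qed.

Lemma pcore_normal_neq1 (gT : finGroupType) (pi : nat_pred) (H G : {group gT}) :
  H <| G -> 'O_pi(H) != 1 -> 'O_pi(G) != 1.
Proof.
move=> nHG; apply: contraNneq => trG; rewrite -subG1 -trG pcore_max ?pcore_pgroup //.
exact: char_normal_trans (pcore_char _ _) nHG.
Qed.

(** Induction from the top of the series. If [H :&: G0] lies in [K], then [H / K] is a quotient of a
    subgroup of [G1 / G0], hence a [p]-group or a [p']-group. Otherwise the image of [H :&: G0] is a
    nontrivial normal subgroup of [H / K], and the induction hypothesis gives it a nontrivial
    core. *)
Lemma p_solvable_separable (gT : finGroupType) (p : nat) (G : {group gT}) :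
  p_solvable p G -> pi_separable p G.
Proof.
case=> s [path_s <-] {G}.
elim/last_ind: s path_s => [_ | s G1 IHs] /=.
  by move=> H K /subset_trans sH1 _ /negP[]; rewrite sH1 ?sub1G.
rewrite rcons_path last_rcons => /andP[path_s /andP[nG01 pG01]] H K sHG1 nKH nsHK.
set G0 := last _ s in nG01 pG01 IHs.
pose H0 := (H :&: G0)%G; have nH0H : H0 <| H by rewrite (normalGI sHG1).
have [nKH0 nG0H] := (normsI (normG H) (normal_norm nKH), subset_trans sHG1 (normal_norm nG01)).
have [sH0K | nsH0K] := boolP (H0 \subset K).
  have ntHK : H / K != 1 by rewrite -subG1 quotient_sub1 ?normal_norm.
  have iso := third_isog sH0K nH0H nKH; have iso2 := second_isog nG0H.
  have pHK (rho : nat_pred) : rho.-group (G1 / G0) -> 'O_rho(H / K) != 1.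
    move=> rhoG; rewrite pcore_pgroup_id // -(isog_pgroup _ iso) quotient_pgroup //=.
    by rewrite setIC (isog_pgroup _ iso2) (pgroupS _ rhoG) ?quotientS.
  by case/orP: pG01 => /pHK-> //; rewrite orbT.
have nKH0' : H0 \subset 'N(K) := subset_trans (subsetIl _ _) (normal_norm nKH).
have nKH0K : H0 / K <| H / K by rewrite quotient_normal.
have := IHs path_s H0 (K :&: H0)%G (subsetIr _ _).
rewrite /normal subsetIr normsI ?normG // subsetI subxx !andbT => /(_ isT nsH0K).
have iso pi := isog_pcore pi (second_isog nKH0').
by rewrite !(isog_eq1 (iso _)) => /orP[] /(pcore_normal_neq1 nKH0K)-> //; rewrite orbT.
Qed.

(** The Hall-Higman argument. If [C] is not inside [V], then [C / Z] has a nontrivial core. The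
    preimage of the [pi]-core is a normal [pi]-subgroup of [G], so it lies in [V]. The preimage of
    the [pi^']-core splits over the central subgroup [Z], and its complement is a normal
    [pi^']-subgroup of [G], hence trivial. *)
Lemma pi_separable_cent_pcore (gT : finGroupType) (pi : nat_pred) (G : {group gT}) :
  pi_separable pi G -> 'O_pi^'(G) = 1 -> 'C_G('O_pi(G)) \subset 'O_pi(G).
Proof.
move=> sepG trG; set V := 'O_pi(G); set C := 'C_G(V).
have nVG : V <| G := pcore_normal _ _.
have nCG : C <| G by rewrite /normal subsetIl normsI ?normG // norms_cent // normal_norm.
pose Z := (C :&: V)%G; have nZG : Z <| G := normalI nCG nVG.
have nZC : Z <| C by rewrite /normal subsetIl (subset_trans (normal_sub nCG)) ?normal_norm.
have cVC : C \subset 'C(V) := subsetIr _ _.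
apply: contraT => nsCV.
have nsCZ : ~~ (C \subset Z) by apply: contra nsCV => sCZ; rewrite (subset_trans sCZ) ?subsetIr.
have piZ : pi.-group Z := pgroupS (subsetIr _ _) (pcore_pgroup pi G).
have nDG (rho : nat_pred) : coset Z @*^-1 'O_rho(C / Z) <| G.
  rewrite -[X in _ <| X](quotientGK nZG) cosetpre_normal.
  by rewrite (char_normal_trans (pcore_char _ _)) ?quotient_normal.
have sDC (rho : nat_pred) : coset Z @*^-1 'O_rho(C / Z) \subset C.
  by rewrite sub_cosetpre_quo ?pcore_sub.
have nZD (rho : nat_pred) : Z <| coset Z @*^-1 'O_rho(C / Z) := normal_cosetpre _.
have trD (rho : nat_pred) : coset Z @*^-1 'O_rho(C / Z) \subset Z -> 'O_rho(C / Z) = 1.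
  by move=> sDZ; apply/trivgP; rewrite -(quotient_sub1 (normal_norm (nZD _))) cosetpreK in sDZ.
have /orP[] := sepG C Z (normal_sub nCG) nZC nsCZ; case/eqP; apply: trD.
  rewrite subsetI sDC pcore_max ?nDG //.
  by rewrite -(pquotient_pgroup piZ) ?(normal_norm (nZD _)) //= cosetpreK pcore_pgroup.
set D := (coset Z @*^-1 'O_pi^'(C / Z))%G.
have hallZ : pi.-Hall(D) Z.
  rewrite /pHall normal_sub ?piZ //= -card_quotient ?normal_norm // cosetpreK.
  exact: pcore_pgroup.
have /splitsP[B /complP[tiZB defD]] := SchurZassenhaus_split (pHall_Hall hallZ) (nZD _).
have sBD : B \subset D by rewrite -defD mulG_subr.
have cZB : B \subset 'C(Z).
  by rewrite (subset_trans sBD) // (subset_trans (sDC _)) // (subset_trans cVC) ?centS ?subsetIr.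
have nBD : B <| D.
  by rewrite /normal sBD -defD mul_subG ?normG // (subset_trans _ (cent_sub _)) // centsC.
have hallB : pi^'.-Hall(D) B by rewrite -(compl_pHall _ hallZ); apply/complP.
suffices sBZ : B \subset Z by rewrite -[coset Z @*^-1 _]/(gval D) -[gval D]defD mul_subG.
rewrite (subset_trans _ (sub1G _)) // -trG pcore_max ?(pHall_pgroup hallB) //.
by rewrite -(normal_Hall_pcore hallB nBD) (char_normal_trans (pcore_char _ _)) ?nDG.
Qed.

(** * Normal [p]-complements *)

(** [X] lies in the normal [p]-complement [K], and [[~: K, Y]] lies in [K :&: Y = 1]. *)
Lemma p_nilpotent_cent (gT : finGroupType) (p : nat) (H X Y : {group gT}) :
  p_nilpotent p H -> X \subset H -> p^'.-group X -> Y <| H -> p.-group Y ->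
  X \subset 'C(Y).
Proof.
case=> K [nKH hallK] sXH p'X nYH pY.
have sXK : X \subset K by rewrite (sub_normal_Hall hallK).
have tiKY : K :&: Y = 1.
  by rewrite setIC coprime_TIg // (pnat_coprime pY (pHall_pgroup hallK)).
apply: subset_trans sXK _; apply/commG1P/trivgP; rewrite -tiKY subsetI.
rewrite commg_subl commg_subr (subset_trans (normal_sub nYH) (normal_norm nKH)).
by rewrite (subset_trans (normal_sub nKH) (normal_norm nYH)).
Qed.

Lemma p_nilpotent_morphim (aT rT : finGroupType) (p : nat) (D G : {group aT})
    (f : {morphism D >-> rT}) :
  G \subset D -> p_nilpotent p G -> p_nilpotent p (f @* G).
Proof.
move=> sGD [K [nKG hallK]]; exists (f @* K)%G; split; first exact: morphim_normal.
by rewrite morphim_pHall // (subset_trans (normal_sub nKG)).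
Qed.

Lemma p_nilpotent_quotient (gT : finGroupType) (p : nat) (H N : {group gT}) :
  H \subset 'N(N) -> p_nilpotent p H -> p_nilpotent p (H / N).
Proof. exact: p_nilpotent_morphim. Qed.

Lemma p_nilpotent_isog (gT rT : finGroupType) (p : nat) (G : {group gT}) (H : {group rT}) :
  G \isog H -> p_nilpotent p G -> p_nilpotent p H.
Proof. by case/isogP=> f _ <-; apply: p_nilpotent_morphim. Qed.

Lemma p_nilpotent_core (gT : finGroupType) (p : nat) (H : {group gT}) :
  p_nilpotent p H -> p^'.-Hall(H) 'O_p^'(H).
Proof. by case=> K [nKH hallK]; rewrite (normal_Hall_pcore hallK nKH). Qed.

(** * A criterion for [G] to be a [p]-group *)

(** With [K] the [p]-complement of ['C_G[a]], the group [[~: M, K]] satisfies the last hypothesis,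
    so [K] centralises [M] and is trivial. Thus every ['C_G[a]] is a [p]-group; for [q != p] an
    [A]-invariant Sylow [q]-subgroup is generated by its trivial fixed-point subgroups. *)
Lemma pgroup_fixed_criterion (gT : finGroupType) (p r : nat) (G A : {group gT}) :
    prime r -> r.-abelem A -> #|A| = (r ^ 2)%N ->
    A \subset 'N(G) -> coprime #|G| #|A| ->
    'C_G('O_p(G)) \subset 'O_p(G) -> p.-group 'C_G(A) ->
    {in A^#, forall a, p_nilpotent p 'C_G[a]} ->
    (forall X : {group gT}, p.-group X -> X \subset G ->
       {in A^#, forall c, X \subset [~: G, <[c]>]} -> X :=: 1) ->
  p.-group G.
Proof.
move=> pr_r abelA oA nGA coGA cMM pCA nilC keyX.
have [rA abA eA] := and3P abelA; have solA := abelian_sol abA.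
have ordA c : c \in A^# -> prime #[c].
  by case/setD1P=> ntc Ac; rewrite (abelem_order_p abelA).
have sAc c : c \in A^# -> <[c]> \subset A by rewrite cycle_subG => /setD1P[].
set M := 'O_p(G) in cMM; have pM : p.-group M := pcore_pgroup p G.
have nMG : M <| G := pcore_normal p G; have sMG := normal_sub nMG.
have nMA : A \subset 'N(M) := char_norm_trans (pcore_char p G) nGA.
have pC a : a \in A^# -> p.-group 'C_G[a].
  move=> A1a; have [nta Aa] := setD1P A1a.
  set C := ('C_G[a])%G; set K := 'O_p^'(C).
  have hallK : p^'.-Hall(C) K := p_nilpotent_core (nilC a A1a).
  have p'K := pHall_pgroup hallK; have sKC : K \subset C := pcore_sub _ _.
  have sKG : K \subset G := subset_trans sKC (subsetIl _ _).
  have nCA : A \subset 'N(C).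
    rewrite /= -cent_cycle normsI // norms_cent // cents_norm //.
    by rewrite centsC (subset_trans (sAc a A1a)).
  have nKA : A \subset 'N(K) := char_norm_trans (pcore_char _ _) nCA.
  have coKA := coprimeSg sKG coGA.
  suffices K1 : [~: M, K] = 1.
    have sKM : K \subset M.
      by apply: subset_trans cMM; rewrite subsetI sKG centsC; apply/commG1P.
    have K1' : K :=: 1.
      by rewrite -(setIidPr sKM) coprime_TIg // (pnat_coprime pM p'K).
    have := hallK; rewrite K1' pHallE sub1G cards1 /= eq_sym.
    by rewrite partn_eq1 ?cardG_gt0 // (eq_pnat _ (negnK _)).
  apply: (keyX [~: M, K]%G) => [||c A1c /=].
  - by rewrite (pgroupS _ pM) // commg_subl (subset_trans sKG) ?normal_norm.
  - by rewrite (subset_trans (commgSS sMG sKG)) // commg_subl normG.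
  have [ntc Ac] := setD1P A1c; set D := [~: G, <[c]>].
  have nDG : G \subset 'N(D) := commg_norml _ _.
  have sDG : D \subset G by rewrite commg_subl cycle_subG (subsetP nGA).
  have solc := abelian_sol (cycle_abelian c); have sAc' := sAc c A1c.
  (* If [c] generates [<[a]>], then modulo [[~: G, <[c]>]] the group [M] is covered by ['C_M[c]],
     which [K] centralises. Otherwise ['C_K[c]] lies in the [p]-group ['C_G(A)], so it is trivial
     and [K = [~: K, <[c]>]]. *)
  have [ca | nca] := boolP (c \in <[a]>).
    have eqac := cycle_prime_eq (ordA a A1a) ca ntc.
    have defM := coprime_sol_comm_cent solc (subset_trans sAc' nMA)
       (coprimegS sAc' (coprimeSg sMG coGA)).
    have nDM := subset_trans sMG nDG; have nDK := subset_trans sKG nDG.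
    rewrite -quotient_cents2 //.
    have sMC : M / D \subset 'C_M[c] / D.
      rewrite quotientSK // -cent_cycle (subset_trans _ (mulSg _ (commSg <[c]> sMG))) //.
      by rewrite -{1}[M]defM.
    apply: subset_trans sMC _; rewrite quotient_cents // centsC.
    apply: p_nilpotent_cent (nilC a A1a) sKC p'K _ _; last by rewrite (pgroupS _ pM) ?subsetIl.
    rewrite /=; have -> : 'C[c] = 'C[a] by rewrite -!cent_cycle eqac.
    have nMC : 'C_G[a] \subset 'N(M) by rewrite (subset_trans (subsetIl _ _)) ?normal_norm.
    rewrite /normal setSI //= normsI //.
    by rewrite (subset_trans (subsetIr _ _)) ?normG.
  have regK : 'C_K(<[c]>) = 1.
    rewrite cent_cycle; apply/trivgP.
    have sCA : 'C_K[c] \subset 'C_G(A).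
      by rewrite -(abelem2_cent1 G pr_r abelA oA A1a Ac nca) setSI.
    rewrite -(coprime_TIg (pnat_coprime pCA p'K)).
    by rewrite subsetI sCA subsetIl.
  have := coprime_sol_comm_cent solc (subset_trans sAc' nKA) (coprimegS sAc' coKA).
  rewrite regK mulg1 => defK.
  have sKD : K \subset D by rewrite -[K]defK commSg.
  by rewrite (subset_trans (commgS _ sKD)) // commg_subr (subset_trans sMG).
move=> {keyX}; apply/pgroupP=> q pr_q qG; rewrite inE /=; apply: contraLR qG => nqp.
have [S sylS nSA] := sol_coprime_Sylow_exists q solA nGA coGA.
have [qS sSG] := (pHall_pgroup sylS, pHall_sub sylS).
have: S \subset [1 gT].
  apply: (@coprime_abelem_gen_cent1 _ r A S 1%G pr_r abelA oA) => //.
  - exact: nilpotent_sol (pgroup_nil qS).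
  - exact: coprimeSg coGA.
  move=> a A1a; have pCS : p.-group 'C_S[a] by rewrite (pgroupS _ (pC a A1a)) ?setSI.
  have qCS : p^'.-group 'C_S[a].
    rewrite (pgroupS (subsetIl _ _)) //; apply: sub_in_pnat qS => x _ /eqnP->.
    by rewrite !inE.
  by apply/trivgP; rewrite /= -['C_S[a]]setIid (coprime_TIg (pnat_coprime pCS qCS)).
rewrite subG1 => /eqP S1; have := card_Hall sylS; rewrite S1 cards1 => /esym/eqP.
by rewrite partn_eq1 ?cardG_gt0 // p'natE.
Qed.

Lemma p_nilpotent_cent_fixed (gT : finGroupType) (p : nat) (G V Q : {group gT}) a :
    V <| G -> p.-group V -> Q \subset G -> p^'.-group Q ->
    p_nilpotent p 'C_G[a] ->
  'C_Q[a] \subset 'C('C_V[a]).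
Proof.
move=> nVG pV sQG p'Q nilC.
apply: (@p_nilpotent_cent _ p 'C_G[a]%G 'C_Q[a]%G 'C_V[a]%G) => //.
- exact: setSI.
- exact: pgroupS (subsetIl _ _) p'Q.
- apply/andP; split; first exact: setSI (normal_sub nVG).
  apply: normsI.
    by rewrite (subset_trans (subsetIl _ _)) ?normal_norm.
  by rewrite (subset_trans (subsetIr _ _)) ?normG.
exact: pgroupS (subsetIl _ _) pV.
Qed.

Lemma Sylow_cent_all (gT : finGroupType) (K S : {group gT}) :
    (forall q, prime q -> q %| #|K| -> exists2 Q : {group gT}, q.-Sylow(K) Q & Q \subset 'C(S)) ->
  K \subset 'C(S).
Proof.
move=> cSyl; suffices /eqP <-: 'C_K(S) == K by rewrite subsetIr.
rewrite eqEcard subsetIl dvdn_leq ?cardG_gt0 //.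
apply/dvdn_partP=> // q; rewrite mem_primes => /and3P[pr_q _ qK].
have [Q sylQ cSQ] := cSyl q pr_q qK.
rewrite -(card_Hall sylQ) cardSg // subsetI cSQ andbT.
exact: pHall_sub sylQ.
Qed.

(** * Critical [p]-subgroups of [G / K], where [K / V] is a [p']-group *)

Section KeyStep.

Variables (gT : finGroupType) (p r : nat) (G A : {group gT}).
Hypotheses (pr_r : prime r) (abelA : r.-abelem A) (oA : #|A| = (r ^ 2)%N).
Hypotheses (nGA : A \subset 'N(G)) (coGA : coprime #|G| #|A|).
Hypothesis nilC : {in A^#, forall a, p_nilpotent p 'C_G[a]}.
Let V := ('O_p(G))%G.
Hypothesis cVV : 'C_G(V) \subset V.
Variable K : {group gT}.
Hypotheses (sVK : V \subset K) (nKG : K <| G) (nKA : A \subset 'N(K)).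
Hypothesis p'K : p^'.-group (K / V).

Let nVG : V <| G := pcore_normal p G.
Let pV : p.-group V := pcore_pgroup p G.

(** [Q] is [A]-invariant and [P] is a Sylow [p]-subgroup of ['N_X(Q)], which covers [X / K] by the
    Frattini argument. Then [[~: Q, P]] centralises [V], so it lies in [V :&: Q = 1]. *)
Lemma critical_Sylow_cent (q : nat) (X : {group gT}) :
    prime q -> q != p -> K \subset X -> X \subset G -> p.-group (X / K) ->
    {in A^#, forall c, X \subset K * [~: G, <[c]>]} ->
  exists Q P : {group gT}, [/\ q.-Sylow(K) Q, p.-group P, K * P = X & P \subset 'C(Q)].
Proof.
move=> pr_q nqp sKX sXG pXK critX.
have [rA abA eA] := and3P abelA; have solA := abelian_sol abA.
have sKG := normal_sub nKG; have nVA : A \subset 'N(V) := char_norm_trans (pcore_char p G) nGA.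
have [Q sylQ nQA] := sol_coprime_Sylow_exists q solA nKA (coprimeSg sKG coGA).
have [qQ sQK] := (pHall_pgroup sylQ, pHall_sub sylQ); have sQG := subset_trans sQK sKG.
have p'Q : p^'.-group Q.
  by apply: sub_in_pnat qQ => x _ /eqnP->; rewrite !inE.
have coVQ : coprime #|V| #|Q| := pnat_coprime pV p'Q.
pose L := ('N_G(Q))%G; have sLG : L \subset G := subsetIl _ _.
have nQL : L \subset 'N(Q) := subsetIr _ _.
have sQL : Q \subset L by rewrite subsetI sQG normG.
have defG : K * L = G := Frattini_arg nKG sylQ.
have nLA : A \subset 'N(L) by rewrite normsI // norms_norm.
have [P sylP] := Sylow_exists p (X :&: L).
have [pP /subsetIP[sPX sPL]] := (pHall_pgroup sylP, pHall_sub sylP).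
have nKL := subset_trans sLG (normal_norm nKG).
have nVL := subset_trans sLG (normal_norm nVG).
have cVQP : [~: Q, P] \subset 'C(V).
  apply: (@coprime_series_cent _ r V L Q A P pr_r abelA oA nLA) => //.
  - exact: coprimeSg coGA.
  - by rewrite join_subG nQL.
  - exact: pgroup_nil qQ.
  - exact: pgroup_nil pV.
  - by rewrite join_subG nVL.
  - exact: coprimeSg (normal_sub nVG) coGA.
  - by move=> a A1a; apply: p_nilpotent_cent_fixed (nilC A1a).
  (* Since [G = K * L], the group [[~: G, <[c]>]] lies in [K * D], and so [P] lies in
     [(K :&: L) * D]. Modulo [D] the factor [K :&: L] is a [p']-group, because [V :&: L] centralises
     [Q] and hence lies in [D]; so the [p]-group [P] lies in [D]. *)
  move=> c D A1c sDL nDL sLcD sCD.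
  have [ntc Ac] := setD1P A1c; have nKc : <[c]> \subset 'N(K) by rewrite cycle_subG (subsetP nKA).
  have nGc : <[c]> \subset 'N(G) by rewrite cycle_subG (subsetP nGA).
  have sGc : [~: G, <[c]>] \subset G by rewrite commg_subl.
  have sGcKD : [~: G, <[c]>] \subset K * D.
    rewrite -quotientSK ?(subset_trans sGc (normal_norm nKG)) //.
    rewrite quotientR ?(normal_norm nKG) // -{1}defG quotientMidl -quotientR //.
    exact: quotientS.
  have sPKD : P \subset (K :&: L) * D.
    rewrite setIC group_modr // subsetI sPL /=.
    rewrite (subset_trans sPX) // (subset_trans (critX c A1c)) //.
    by rewrite -{2}(mulGid K) -mulgA mulgS.
  have sVLC : V :&: L \subset 'C_L(Q).
    rewrite subsetI subsetIr /=; apply/commG1P/trivgP; rewrite -(coprime_TIg coVQ) subsetI.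
    rewrite commg_subr (subset_trans (subsetIr _ _)) // andbT.
    rewrite (subset_trans (commSg _ (subsetIl _ _))) // commg_subl.
    by rewrite (subset_trans sQL).
  have sIL : K :&: L \subset L := subsetIr _ _.
  have p'ID : p^'.-group ((K :&: L) / D).
    have: p^'.-group ((K :&: L) / V) by rewrite (pgroupS _ p'K) ?quotientS ?subsetIl.
    rewrite /pgroup !card_quotient ?(subset_trans sIL) //; apply: pnat_dvd.
    rewrite -(indexgI _ V); apply: indexgS.
    by rewrite (subset_trans _ sCD) // (subset_trans _ sVLC) //= subsetI subsetIr subIset ?sIL.
  have nDP := subset_trans sPL nDL.
  rewrite -quotient_sub1 //.
  have sPI : P / D \subset (K :&: L) / D.
    by rewrite (subset_trans (quotientS _ sPKD)) // quotientMidr.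
  rewrite -(coprime_TIg (pnat_coprime (quotient_pgroup D pP) p'ID)).
  by rewrite subsetI subxx.
exists Q, P; split=> //.
  have sKP : X \subset K * P.
    rewrite -quotientSK ?(subset_trans sXG) ?normal_norm //.
    have sylPK : p.-Sylow((X :&: L) / K) (P / K).
      by rewrite quotient_pHall // (subset_trans sPL).
    have defX : (X :&: L) / K = X / K.
      by rewrite -(quotientMidl K (X :&: L)) setIC group_modl // defG (setIidPr sXG).
    by rewrite defX in sylPK; rewrite -(pHall_id sylPK pXK).
  by apply/eqP; rewrite eqEsubset sKP mul_subG.
rewrite centsC; apply/commG1P/trivgP.
have sQP : [~: Q, P] \subset Q by rewrite commg_subl (subset_trans sPL).
rewrite -(coprime_TIg coVQ) subsetI sQP andbT (subset_trans _ cVV) // subsetI cVQP.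
by rewrite (subset_trans sQP).
Qed.


(** A Sylow [p]-subgroup of [X / V] centralises a Sylow [q]-subgroup of [K / V] for each [q], hence
    all of [K / V]. As [K / V] is a [p']-group containing its centraliser, that Sylow subgroup is
    trivial. *)
Lemma critical_trivial_mod (X : {group gT}) :
    'C_(G / V)(K / V) \subset K / V ->
    K \subset X -> X \subset G -> p.-group (X / K) ->
    {in A^#, forall c, X \subset K * [~: G, <[c]>]} ->
  X \subset K.
Proof.
move=> cKK sKX sXG pXK critX.
have nVX := subset_trans sXG (normal_norm nVG); have nVK := subset_trans sKX nVX.
have nKX := subset_trans sXG (normal_norm nKG).
have [S sylS] := Sylow_exists p (X / V).
have [pS sSX] := (pHall_pgroup sylS, pHall_sub sylS).
have cKS : K / V \subset 'C(S).
  apply: Sylow_cent_all => q pr_q qK.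
  have nqp : q != p by have:= pgroupP p'K q pr_q qK; rewrite !inE.
  have [Q [P [sylQ pP defX cPQ]]] := critical_Sylow_cent pr_q nqp sKX sXG pXK critX.
  have sQK := pHall_sub sylQ; have sPX : P \subset X by rewrite -defX mulG_subr.
  have sylPV : p.-Sylow(X / V) (P / V).
    rewrite pHallE quotientS //= -defX quotientMl // TI_cardMg; last first.
      by rewrite setIC coprime_TIg // (pnat_coprime (quotient_pgroup V pP) p'K).
    rewrite partnM ?cardG_gt0 // part_p'nat // mul1n part_pnat_id //.
    exact: quotient_pgroup.
  (* [P] depends on [q]. Conjugation carries [P / V] to the fixed [S], and [Q / V] to another Sylow
     [q]-subgroup of [K / V]. *)
  have [x Xx defS] := Sylow_trans sylPV sylS.
  have nKx : (K / V) :^ x = K / V by rewrite (normP _) // (subsetP _ x Xx) // quotient_norms.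
  exists ((Q / V) :^ x)%G.
    by rewrite /= -nKx pHallJ2 quotient_pHall // (subset_trans sQK).
  by rewrite defS centJ conjSg quotient_cents // centsC.
have S1 : S :=: 1.
  rewrite -(setIid S) coprime_TIg // (pnat_coprime pS) //; apply: pgroupS p'K.
  by rewrite (subset_trans _ cKK) // subsetI (subset_trans sSX) ?quotientS // centsC.
have p'XV : p^'.-group (X / V).
  by have := card_Hall sylS; rewrite S1 cards1 => /esym/eqP; rewrite partn_eq1.
rewrite -quotient_sub1 // -(setIid (X / K)) coprime_TIg // (pnat_coprime pXK) //.
by apply: pnat_dvd p'XV; rewrite !card_quotient // indexgS.
Qed.

End KeyStep.

(** * The coprime case *)

(** The [p]-complement of [G / V] is [K / V], once the criterion, fed by [critical_trivial_mod],
    shows that [G / K] is a [p]-group. *)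
Lemma coprime_pcore_quotient_p_nilpotent (gT : finGroupType) (p r : nat) (G A : {group gT}) :
    prime r -> r.-abelem A -> #|A| = (r ^ 2)%N ->
    A \subset 'N(G) -> coprime #|G| #|A| -> pi_separable p G -> 'O_p^'(G) = 1 ->
    {in A^#, forall a, p_nilpotent p 'C_G[a]} -> p.-group 'C_G(A) ->
  p_nilpotent p (G / 'O_p(G)).
Proof.
move=> pr_r abelA oA nGA coGA sepG trG nilC pCA.
have [rA abA eA] := and3P abelA; have solA := abelian_sol abA.
pose V := ('O_p(G))%G; have nVG : V <| G := pcore_normal p G.
have cVV : 'C_G(V) \subset V := pi_separable_cent_pcore sepG trG.
have nVA : A \subset 'N(V) := char_norm_trans (pcore_char p G) nGA.
pose K := (coset V @*^-1 'O_p^'(G / V))%G.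
have nVK : V <| K := normal_cosetpre _.
have defK : K / V = 'O_p^'(G / V) := cosetpreK _.
have nKG : K <| G.
  by rewrite -[X in _ <| X](quotientGK nVG) cosetpre_normal pcore_normal.
have nKA : A \subset 'N(K).
  apply: cosetpre_norms => //; apply: char_norm_trans (pcore_char _ _) _.
  exact: quotient_norms.
have p'KV : p^'.-group (K / V) by rewrite defK pcore_pgroup.
have cKK : 'C_(G / V)(K / V) \subset K / V.
  rewrite defK; apply: pi_separable_cent_pcore.
    exact/pi_separableC/pi_separable_quotient.
  by rewrite (eq_pcore _ (negnK p)) trivg_pcore_quotient.
have sKG := normal_sub nKG; have coKA := coprimeSg sKG coGA.
have [abelAK oAK] := quotient_abelem_TI abelA oA nKA coKA.
have trGK : 'O_p^'(G / K) = 1.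
  have iso := third_isog (normal_sub nVK) nVG nKG.
  apply/eqP; rewrite -(isog_eq1 (isog_pcore _ iso)) defK.
  by rewrite /= trivg_pcore_quotient.
have pGK : p.-group (G / K).
  apply: (@pgroup_fixed_criterion _ p r (G / K) (A / K) pr_r abelAK oAK).
  - exact: quotient_norms.
  - by rewrite coprime_morph.
  - exact: pi_separable_cent_pcore (pi_separable_quotient nKG sepG) trGK.
  - by rewrite coprime_sol_quotient_cent // quotient_pgroup.
  - move=> x /setD1P[ntx /morphimP[a nMa Aa def_x]].
    have A1a : a \in A^#.
      by rewrite !inE Aa andbT; apply: contraNneq ntx => a1; rewrite def_x a1 morph1.
    rewrite def_x coprime_quotient_cent1 //; last first.
      by apply: coprimegS coKA; rewrite cycle_subG.
    apply: p_nilpotent_quotient (nilC a A1a).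
    by rewrite (subset_trans (subsetIl _ _)) ?normal_norm.
  move=> X pX sXG critX; pose Y := (coset K @*^-1 X)%G.
  have defX : Y / K = X := cosetpreK _.
  suffices sYK : Y \subset K.
    by apply/trivgP; rewrite -defX quotient_sub1 // normal_norm ?normal_cosetpre.
  apply: (@critical_trivial_mod _ p r G A pr_r abelA oA nGA coGA nilC cVV K) => //.
  - exact: normal_sub nVK.
  - exact: sub_cosetpre.
  - by rewrite sub_cosetpre_quo.
  - by rewrite defX.
  move=> c A1c; have [ntc Ac] := setD1P A1c.
  have nKc : <[c]> \subset 'N(K) by rewrite cycle_subG (subsetP nKA).
  have sGc : [~: G, <[c]>] \subset 'N(K).
    by rewrite (subset_trans _ (normal_norm nKG)) // commg_subl cycle_subG (subsetP nGA).
  rewrite -quotientSK ?(subset_trans _ (normal_norm nKG)) ?sub_cosetpre_quo //.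
  rewrite defX quotientR ?(normal_norm nKG) // quotient_cycle ?(subsetP nKA) //.
  rewrite critX // !inE mem_quotient // andbT; apply: contraNneq ntc => c1.
  rewrite -in_set1 -[[set 1]]/(gval 1%G) /= -(coprime_TIg coKA) inE Ac andbT.
  by rewrite coset_idr ?(subsetP nKA).
exists (K / V)%G; split; first exact: quotient_normal.
rewrite /pHall quotientS //= p'KV -card_quotient; last first.
  by rewrite quotient_norms ?normal_norm.
rewrite (card_isog (third_isog (normal_sub nVK) nVG nKG)) (eq_pnat _ (negnK p)).
exact: pGK.
Qed.

(** * Good actions by conjugation *)

(* [good_action] for conjugation inside one ambient group. *)
Definition good_on (gT : finGroupType) (A G : {group gT}) : Prop :=
  forall B H : {group gT}, B \subset A -> H \subset G -> B \subset 'N(H) ->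
  H \subset [~: H, B] * 'C_H(B).

Lemma good_quotient (gT : finGroupType) (A G N : {group gT}) :
  N <| G -> A \subset 'N(N) -> good_on A G -> good_on (A / N) (G / N).
Proof.
move=> nNG nNA goodA B H sBA sHG nHB.
(* The preimage of [B] is cut down to [A], where goodness applies; it still maps onto [B]. *)
pose B1 := (A :&: coset N @*^-1 B)%G; pose H1 := (coset N @*^-1 H)%G.
have defB : B1 / N = B by rewrite quotient_setIpre (setIidPr sBA).
have defH : H1 / N = H := cosetpreK _.
have sBN : B1 \subset 'N(N) := subset_trans (subsetIl _ _) nNA.
have sHN : H1 \subset 'N(N) := normal_norm (normal_cosetpre _).
have nHB1 : B1 \subset 'N(H1) by rewrite cosetpre_norms ?defB.
have sH1G : H1 \subset G by rewrite sub_cosetpre_quo.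
have := quotientS N (goodA B1 H1 (subsetIl _ _) sH1G nHB1).
have sRH : [~: H1, B1] \subset H1 by rewrite commg_subl.
rewrite quotientMl ?(subset_trans sRH) // quotientR // defB defH => sH.
apply: subset_trans sH (mulgS _ _); rewrite -[in X in _ \subset X]defB -[in X in _ \subset X]defH.
by rewrite subsetI quotientS ?subsetIl // quotient_cents ?subsetIr.
Qed.

(** The preimage [C] of the fixed points satisfies [[~: C, B] \subset N], so goodness for [C] places
    it in [N * 'C_G(B)]. This stands in for coprimality. *)
Lemma good_quotient_cent (gT : finGroupType) (A B G N : {group gT}) :
    N <| G -> A \subset 'N(G) -> A \subset 'N(N) -> good_on A G -> B \subset A ->
  'C_(G / N)(B / N) = 'C_G(B) / N.
Proof.
move=> nNG nGA nNA goodA sBA; have nNB := subset_trans sBA nNA.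
apply/eqP; rewrite eqEsubset [X in _ && X]subsetI quotientS ?subsetIl //=.
rewrite [X in _ && X]quotient_cents ?subsetIr ?andbT //.
pose C := (coset N @*^-1 'C_(G / N)(B / N))%G.
have defC : C / N = 'C_(G / N)(B / N) := cosetpreK _.
have nNC : C \subset 'N(N) := normal_norm (normal_cosetpre _).
have sCG : C \subset G by rewrite sub_cosetpre_quo ?subsetIl.
have sCBN : [~: C, B] \subset N.
  by rewrite -quotient_cents2 // defC subsetIr.
have nCB : B \subset 'N(C).
  by rewrite -commg_subl (subset_trans sCBN) // sub_cosetpre.
rewrite -defC quotientSK // (subset_trans (goodA B C sBA sCG nCB)) //.
by rewrite mulgSS // setSI.
Qed.

(** Goodness gives [[~: S, A] = [~: S, A, A]], which forces [[~: S, A] = 1] in the nilpotent group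
    [S <*> A]. *)
Lemma good_pgroup_cent (gT : finGroupType) (r : nat) (A G S : {group gT}) :
    good_on A G -> r.-group A -> S \subset G -> r.-group S -> A \subset 'N(S) ->
  S \subset 'C(A).
Proof.
move=> goodA rA sSG rS nSA; apply/commG1P.
have nilSA : nilpotent (S <*> A).
  by apply: (@pgroup_nil _ r); rewrite /= norm_joinEr // pgroupM rS.
set R := [~: S, A]; have sRS : R \subset S by rewrite commg_subl.
have nRA : A \subset 'N(R) := commg_normr _ _.
have nRS : S \subset 'N(R) := commg_norml _ _.
have sR : R \subset [~: R, A].
  rewrite gen_subG; apply/subsetP=> _ /imset2P[x a Sx Aa ->].
  have /mulsgP[u v Ru /setIP[Sv cAv] ->] := subsetP (goodA A S (subxx _) sSG nSA) x Sx.
  have /commgP/eqP cva := centP cAv a Aa.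
  rewrite commMgJ cva mulg1 memJ_norm ?mem_commg //.
  apply/normP; rewrite conjsRg (normP (subsetP nRS v Sv)).
  by rewrite (normP (subsetP (cent_sub A) v cAv)).
apply/eqP; have /forall_inP/(_ R%G) := nilSA; apply; rewrite subsetI /=.
rewrite (subset_trans sRS) ?joing_subl //= (subset_trans sR) // commgS //.
exact: joing_subr.
Qed.

Lemma good_pcore_quotient_p_nilpotent (gT : finGroupType) (p r : nat) (G A : {group gT}) :
    prime p -> prime r -> r.-abelem A -> #|A| = (r ^ 2)%N ->
    A \subset 'N(G) -> good_on A G -> pi_separable p G -> 'O_p^'(G) = 1 ->
    {in A^#, forall a, p_nilpotent p 'C_G[a]} ->
  p_nilpotent p (G / 'O_p(G)).
Proof.
move=> pr_p pr_r abelA oA nGA goodA sepG trG nilC.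
have [rA abA eA] := and3P abelA.
pose V := ('O_p(G))%G; have nVG : V <| G := pcore_normal p G.
have pV : p.-group V := pcore_pgroup p G; have sVG := normal_sub nVG.
have cVV : 'C_G(V) \subset V := pi_separable_cent_pcore sepG trG.
have nVA : A \subset 'N(V) := char_norm_trans (pcore_char p G) nGA.
have nVN : G \subset 'N(V) := normal_norm nVG.
have [eqpr | nepr] := eqVneq p r.
  have cVA : V \subset 'C(A).
    by apply: good_pgroup_cent goodA rA sVG _ nVA; rewrite -eqpr.
  have sRG : [~: G, A] \subset G by rewrite commg_subl.
  (* Three subgroups lemma: [[~: A, V] = 1], and [[~: V, G]] lies in [V], which [A] centralises, so
     [[~: G, A]] centralises [V]. *)
  have sRV : [~: G, A] \subset V.
    apply: subset_trans cVV; rewrite subsetI sRG /=.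
    apply/commG1P; apply: three_subgroup; first by rewrite [[~: A, _]]commGC (commG1P cVA) comm1G.
    by apply/commG1P; rewrite (subset_trans _ cVA) // commg_subl.
  have cGA : G \subset 'C(A).
    rewrite (subset_trans (goodA A G (subxx _) (subxx _) nGA)) // mul_subG ?subsetIr //.
    exact: subset_trans cVA.
  have [a A1a] : exists a, a \in A^#.
    apply/set0Pn; rewrite setD_eq0 subG1 trivg_card1 oA.
    by rewrite -(expn0 r) eqn_exp2l ?prime_gt1.
  have := nilC a A1a; rewrite (setIidPl _) => [nilG|].
    exact: p_nilpotent_quotient (gFnorm _ _) nilG.
  rewrite (subset_trans cGA) // -cent_cycle centS // cycle_subG.
  by case/setD1P: A1a.
have coVA : coprime #|V| #|A|.
  by rewrite (pnat_coprime pV) // (pi_pnat rA) // !inE eq_sym.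
(* An [x] of prime order [q != p] in ['C_G(A)] would centralise every ['C_V[a]], hence [V], and so
   would lie in the [p]-group [V]. *)
have pCA : p.-group 'C_G(A).
  apply/pgroupP=> q pr_q /Cauchy[] // x /setIP[Gx cAx] ox; apply: contraT => nqp.
  have qx : q.-group <[x]> by rewrite /pgroup -/#[x] ox pnat_id.
  have p'x : p^'.-group <[x]> by rewrite (pi_pgroup qx).
  have Vx : x \in V.
    apply: (subsetP cVV); rewrite inE Gx -sub_cent1 /=.
    apply: (@coprime_abelem_gen_cent1 _ r A V 'C[x]%G pr_r abelA oA) => //.
      exact: nilpotent_sol (pgroup_nil pV).
    move=> a A1a; have [nta Aa] := setD1P A1a.
    have := p_nilpotent_cent_fixed nVG pV (_ : <[x]> \subset G) p'x (nilC a A1a).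
    rewrite cycle_subG => /(_ Gx); rewrite centsC => sC; rewrite (subset_trans sC) //=.
    rewrite -(cent_cycle x) centS // subsetI subxx cycle_subG.
    by apply/cent1P; apply: (centP cAx).
  have := pgroupS (_ : <[x]> \subset V) pV; rewrite cycle_subG => /(_ Vx) px.
  have := coprime_TIg (pnat_coprime px p'x); rewrite setIid => /eqP.
  by rewrite cycle_eq1 -order_eq1 ox => /eqP q1; rewrite q1 in pr_q.
(* A Sylow [r]-subgroup [T] of [G <*> A] containing [A] cuts out an [A]-invariant Sylow [r]-subgroup
   of [G]. Goodness puts it in the [p]-group ['C_G(A)], so it is trivial. *)
have coGA : coprime #|G| #|A|.
  have sAX : A \subset G <*> A := joing_subr _ _.
  have [T sylT sAT] := Sylow_superset sAX rA.
  have nGX : G <| G <*> A by rewrite /normal joing_subl join_subG normG.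
  have rS : r.-Sylow(G) (T :&: G) := Hall_setI_normal nGX sylT.
  have nSA : A \subset 'N(T :&: G) by rewrite normsI // (subset_trans sAT) ?normG.
  have cSA := good_pgroup_cent goodA rA (subsetIr T G) (pHall_pgroup rS) nSA.
  have pS : p.-group (T :&: G) by rewrite (pgroupS _ pCA) // subsetI subsetIr.
  have rS' : p^'.-group (T :&: G).
    by rewrite (pi_pgroup (pHall_pgroup rS)) // !inE eq_sym.
  have S1 := coprime_TIg (pnat_coprime pS rS').
  rewrite setIid in S1; have := card_Hall rS; rewrite S1 cards1 => /esym/eqP.
  rewrite partn_eq1 ?cardG_gt0 // coprime_sym => r'G.
  exact: pnat_coprime rA r'G.
exact: coprime_pcore_quotient_p_nilpotent pr_r abelA oA nGA coGA sepG trG nilC pCA.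
Qed.

(** The normal subgroup is [O_{p',p}(G)], whose [p]-complement is ['O_p^'(G)]. Goodness lets the
    hypotheses on fixed points descend modulo ['O_p^'(G)]. *)
Theorem good_p_nilpotent_by_p_nilpotent (gT : finGroupType) (p r : nat) (G A : {group gT}) :
    prime p -> prime r -> r.-abelem A -> #|A| = (r ^ 2)%N ->
    A \subset 'N(G) -> G :&: A = 1 -> good_on A G -> pi_separable p G ->
    {in A^#, forall a, p_nilpotent p 'C_G[a]} ->
  exists N : {group gT}, [/\ N <| G, p_nilpotent p N & p_nilpotent p (G / N)].
Proof.
move=> pr_p pr_r abelA oA nGA tiGA goodA sepG nilC.
pose N := ('O_p^'(G))%G; have nNG : N <| G := pcore_normal _ _.
have nNA : A \subset 'N(N) := char_norm_trans (pcore_char _ _) nGA.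
have p'N : p^'.-group N := pcore_pgroup _ _.
have tiNA : N :&: A = 1 by apply/trivgP; rewrite -tiGA setSI ?normal_sub.
have abelAN : r.-abelem (A / N) := quotient_abelem _ abelA.
have oAN : #|A / N| = (r ^ 2)%N by rewrite -(card_isog (quotient_isog nNA tiNA)).
have nGAN : A / N \subset 'N(G / N) := quotient_norms _ nGA.
have goodAN := good_quotient nNG nNA goodA.
have nilCN : {in (A / N)^#, forall a, p_nilpotent p 'C_(G / N)[a]}.
  move=> x /setD1P[ntx /morphimP[a nNa Aa def_x]].
  have A1a : a \in A^#.
    by rewrite !inE Aa andbT; apply: contraNneq ntx => a1; rewrite def_x a1 morph1.
  rewrite def_x -cent_cycle -quotient_cycle //.
  rewrite (good_quotient_cent nNG nGA nNA goodA) ?cycle_subG // cent_cycle.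
  apply: p_nilpotent_quotient (nilC a A1a).
  by rewrite (subset_trans (subsetIl _ _)) ?normal_norm.
have nilW := good_pcore_quotient_p_nilpotent pr_p pr_r abelAN oAN nGAN goodAN
  (pi_separable_quotient nNG sepG) (trivg_pcore_quotient _ _) nilCN.
pose W := (coset N @*^-1 'O_p(G / N))%G; have defW : W / N = 'O_p(G / N) := cosetpreK _.
have nNW : N <| W := normal_cosetpre _.
have nWG : W <| G.
  by rewrite -[X in _ <| X](quotientGK nNG) cosetpre_normal pcore_normal.
exists W; split => //.
  exists N; split=> //; rewrite /pHall normal_sub // p'N -card_quotient ?normal_norm //.
  rewrite defW (eq_pnat _ (negnK p)); exact: pcore_pgroup.
apply: p_nilpotent_isog (third_isog (normal_sub nNW) nNG nWG) _.
by rewrite defW.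
Qed.

(** * Passage to the semidirect product *)

Lemma p_solvable_morphim (aT rT : finGroupType) (p : nat) (D G : {group aT})
    (f : {morphism D >-> rT}) :
  G \subset D -> p_solvable p G -> p_solvable p (f @* G)%G.
Proof.
move=> sGD [s [path_s defG]]; exists [seq (f @* H)%G | H : {group aT} <- s].
have f1 : (f @* 1)%G = 1%G by apply: val_inj; rewrite /= morphim1.
split; last by rewrite -f1 last_map defG.
rewrite -{1}f1 -defG in sGD *; elim/last_ind: s path_s sGD {defG} => //= s K IHs.
rewrite map_rcons !rcons_path last_rcons last_map => /andP[path_s /andP[nHK pHK]] sKD.
rewrite IHs ?(subset_trans (normal_sub nHK)) // morphim_normal //=.
set H := last _ s in nHK pHK *.
have pKH (pi : nat_pred) : pi.-group (K / H) -> pi.-group (f @* K / f @* H).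
  rewrite /pgroup !card_quotient ?morphim_norms ?normal_norm //; apply: pnat_dvd.
  by rewrite index_morphim // subIset ?sKD.
by case/orP: pHK => /pKH->; rewrite ?orbT.
Qed.

Theorem theoremC (gT aT : finGroupType) (p r : nat)
    (G : {group gT}) (A : {group aT}) (phi : {morphism A >-> {perm gT}}) :
  prime p -> prime r ->
  r.-abelem A -> #|A| = (r ^ 2)%N ->
  phi @* A \subset Aut G ->
  good_action phi G ->
  p_solvable p G ->
  (forall a, a \in A -> a != 1 -> p_nilpotent p (act_cent phi G [set a])) ->
  exists N : {group gT},
    [/\ N <| G, p_nilpotent p N & p_nilpotent p (G / N)].
Proof.
move=> pr_p pr_r abelA oA autA goodA solvG nilC.
have gactA : is_groupAction G <<phi>>%act.
  by move=> a Aa; rewrite /= perm_mact (subsetP autA) ?mem_morphim.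
pose to := GroupAction gactA.
pose i1 := [morphism of sdpair1 to]; pose i2 := [morphism of sdpair2 to].
have inj1 : 'injm i1 := injm_sdpair1 to; have inj2 : 'injm i2 := injm_sdpair2 to.
(* [G1] and [A1] are the copies of [G] and [A] in the semidirect product, where [phi] becomes
   conjugation. *)
pose G1 := (i1 @* G)%G; pose A1 := (i2 @* A)%G.
have phiJ x a : x \in G -> a \in A -> i1 (phi a x) = i1 x ^ i2 a.
  by move=> Gx Aa; rewrite /= -sdpair_act.
have phiG x a : x \in G -> a \in A -> phi a x \in G.
  by move=> Gx Aa; rewrite -[phi a x]/(to x a) gact_stable.
have goodA1 : good_on A1 G1.
  move=> B1 H1 sB1 sH1 nHB1.
  pose B := (i2 @*^-1 B1)%G; pose H := (i1 @*^-1 H1)%G.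
  have defB : i2 @* B = B1 by rewrite morphpreK.
  have defH : i1 @* H = H1 by rewrite morphpreK.
  have sBA : B \subset A := subsetIl _ _; have sHG : H \subset G := subsetIl _ _.
  have HJ b x : b \in B -> x \in H -> phi b x \in H.
    case/morphpreP=> Ab B1b /morphpreP[Gx H1x].
    by apply/morphpreP; rewrite phiG // phiJ // memJ_norm // (subsetP nHB1).
  have invBH : act_invariant phi B H.
    by move=> b Bb; apply/subsetP=> _ /imsetP[x Hx ->]; apply: HJ.
  apply/subsetP=> x1; rewrite -{1}defH => /morphimP[x Gx Hx ->].
  have := Hx; rewrite (goodA B H sBA sHG invBH) => /mulsgP[u v Hu Cv def_x].
  have [Hv cBv] : v \in H /\ {in B, forall b, phi b v = v}.
    move: Cv; rewrite inE => /andP[Hv /forall_inP cBv].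
    by split=> // b Bb; apply/eqP/cBv.
  have sRP : act_comm phi H B \subset i1 @*^-1 [~: H1, B1].
    rewrite gen_subG; apply/subsetP=> _ /imset2P[y b Hy Bb ->].
    have [[Ab B1b] [Gy H1y]] := (morphpreP Bb, morphpreP Hy).
    apply/morphpreP; split; first by rewrite groupM ?groupV ?phiG.
    rewrite morphM ?groupV ?phiG // morphV // phiJ //= -commgEl.
    by rewrite mem_commg.
  have /morphpreP[Gu R1u] := subsetP sRP u Hu.
  have Gv := subsetP sHG v Hv; rewrite def_x morphM // mem_mulg // inE.
  rewrite -defH mem_morphim //=; apply/centP=> b1; rewrite -defB => /morphimP[b Ab Bb ->].
  by apply/commgP/conjg_fixP; rewrite /= -phiJ // cBv.
have nilC1 : {in A1^#, forall a, p_nilpotent p 'C_G1[a]}.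
  move=> a1 /setD1P[nta1 /morphimP[a Aa _ def_a1]].
  (* [act_cent] is only a set; [C] is a group with the same elements. *)
  pose C := (G :&: i1 @*^-1 'C[a1])%G.
  have defC : C :=: act_cent phi G [set a].
    apply/setP=> x; rewrite [RHS]inE [LHS]inE; apply: andb_id2l => Gx.
    apply/morphpreP/forall_inP=> [[_ /cent1P cxa] _ /set1P-> | fix_x].
      apply/eqP/(injmP inj1); rewrite ?phiG // phiJ // -def_a1.
      by apply/conjg_fixP/commgP.
    split=> //; apply/cent1P; rewrite def_a1; apply/commgP/conjg_fixP.
    by rewrite -phiJ // (eqP (fix_x a _)) ?inE.
  have -> : 'C_G1[a1] = i1 @* C by rewrite morphim_setIpre.
  apply: p_nilpotent_morphim; rewrite ?subsetIl // defC; apply: nilC => //.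
  by apply: contraNneq nta1 => a_1; rewrite def_a1 a_1 morph1.
have [|||||N1 [nNG1 nilN1 nilGN1]] :=
    good_p_nilpotent_by_p_nilpotent pr_p pr_r _ _ _ _ goodA1 _ nilC1.
- by rewrite injm_abelem.
- by rewrite card_injm.
- exact: im_sdpair_norm.
- exact: im_sdpair_TI.
- by apply: p_solvable_separable; apply: p_solvable_morphim.
(* The inverse of the embedding [i1] brings [N1] back to [G]. *)
pose g := [morphism of invm inj1]; have defG : g @* G1 = G by apply: morphim_invm.
exists (g @* N1)%G; split.
- by rewrite -[X in _ <| X]defG morphim_normal.
- exact: p_nilpotent_morphim (normal_sub nNG1) nilN1.
rewrite -[X in X / _]defG -(morphim_quotm _ nNG1).
exact: p_nilpotent_morphim.
Qed.
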